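(* Consider the problem of finding controllers $u^c_{k-d}$, $k=d,\dots,N$, with $u^c_{k-d}$ being $\mathcal F_{k-d-1}$-measurable, that minimize $$J_N=\mathbb E\Big[\sum_{k=0}^{N}\big(z_k'Qz_k+(u^c_{k-d})'Ru^c_{k-d}\big)+z_{N+1}'\bar P_{N+1}z_{N+1}\Big]$$ subject to $z_{k+1}=\bar A_{\theta_k}z_k+\bar B_{\theta_k}u^c_{k-d}$, $k=0,\dots,N$, with given initial data $z_0,u^c_{-d},\dots,u^c_{-1}$. Let $\bar P_{\theta_{k-1}}$, $\Gamma_{\theta_{k-d-1}}$, $M^i_{\theta_{k-d-1}}$, $F^i_{\theta_{k-1}}$ be the sequences defined in the context by backward recursion from $\bar P_{\theta_N}(N+1)=\bar P_{N+1}$. Then this problem has a unique solution if and only if $\Gamma_{\theta_{k-d-1}}$ is positive definite (almost surely) for every $k=N,N-1,\dots,d$. In this case: (1) the optimal controller is, for $d\le k\le N$, $$u^c_{k-d}=-\Gamma^{-1}_{\theta_{k-d-1}}\Big(M^0_{\theta_{k-d-1}}z_{k-d}+\sum_{i=1}^{d}M^i_{\theta_{k-d-1}}u^c_{k-d-i}\Big);$$ (2) the optimal value of the cost is $$J_N=\mathbb E\Big\{\sum_{k=0}^{d-1}\big[z_k'Qz_k+(u^c_{k-d})'Ru^c_{k-d}\big]+z_d'\bar P_{\theta_{d-1}}z_d-z_d'\sum_{s=0}^{d-1}F^{s+1}_{\theta_{d-1}}\Gamma^{-1}_{\theta_{s-1}}M^0_{\theta_{s-1}}z_s-z_d'\sum_{s=0}^{d}F^{s+1}_{\theta_{d-1}}\Gamma^{-1}_{\theta_{s-1}}\sum_{i=s+1}^{d}M^i_{\theta_{s-1}}u^c_{s-i}\Big\};$$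 (3) the solution of the forward-backward stochastic difference equations $$0=\mathbb E_{k-d-1}[\bar B_{\theta_k}'\lambda_k]+Ru^c_{k-d},\quad \lambda_{k-1}=Qz_k+\mathbb E_{k-1}[\bar A_{\theta_k}'\lambda_k],\quad \lambda_N=\bar P_{N+1}z_{N+1},\quad z_{k+1}=\bar A_{\theta_k}z_k+\bar B_{\theta_k}u^c_{k-d}$$ ($d\le k\le N$) is given, for $d\le k\le N$, by $$\lambda_{k-1}=\bar P_{\theta_{k-1}}z_k-\sum_{s=0}^{d-1}F^{s+1}_{\theta_{k-1}}\Gamma^{-1}_{\theta_{k-d-1+s}}M^0_{\theta_{k-d-1+s}}z_{k-d+s}-\sum_{s=0}^{d-1}F^{s+1}_{\theta_{k-1}}\Gamma^{-1}_{\theta_{k-d-1+s}}\sum_{i=s+1}^{d}M^i_{\theta_{k-d-1+s}}u^c_{k-d-i+s}.$$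
   Context: **Setting.** $n,m\ge 1$, $d\ge 0$ (the input delay) and $N\ge d$ are integers; $A\in\mathbb R^{n\times n}$, $B\in\mathbb R^{n\times m}$ are constant matrices. $\{\theta_k\}_{k\ge 0}$ is a Markov chain with values in $\{0,1\}$ and transition probabilities $\xi_{ij}=P(\theta_{k+1}=j\mid\theta_k=i)$. $\mathcal F_k$ is the $\sigma$-algebra generated by $\theta_0,\dots,\theta_k$, $\mathcal F_{-1}=\{\emptyset,\Omega\}$, and $\mathbb E_k[\cdot]=\mathbb E[\cdot\mid\mathcal F_k]$ (so $\mathbb E_{-1}=\mathbb E$). A prime denotes transpose. For $\theta\in\{0,1\}$, $$\bar A_\theta=\begin{bmatrix}A&(1-\theta)B\\0&(1-\theta)I\end{bmatrix}\in\mathbb R^{(n+m)\times(n+m)},\qquad \bar B_\theta=\begin{bmatrix}\theta B\\\theta I\end{bmatrix}\in\mathbb R^{(n+m)\times m}.$$ The state is $z_k\in\mathbb R^{n+m}$ and the control $u^c_k\in\mathbb R^m$; the initial data $z_0,u^c_{-d},\dots,u^c_{-1}$ are deterministic. The weights $Q\in\mathbb R^{(n+m)\times(n+m)}$, $R\in\mathbb R^{m\times m}$ and $\bar P_{N+1}\in\mathbb R^{(n+m)\times(n+m)}$ are symmetric positive semi-definite. **Notational conventions.** A subscript $\theta_j$ on $\bar P,\Gamma,M^i,\tilde S^1,F^i$ marks the time index: the object is an $\mathcal F_j$-measurable random matrix. It also fixes the step of the recursion at which the object is computed: $\bar P_{\theta_{k-1}}=\bar P_{\theta_{k-1}}(k)$,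 $\Gamma_{\theta_{k-d-1}}=\Gamma_{\theta_{k-d-1}}(k)$, $M^i_{\theta_{k-d-1}}=M^i_{\theta_{k-d-1}}(k)$, $\tilde S^1_{\theta_{k-1}}=\tilde S^1_{\theta_{k-1}}(k)$, $F^i_{\theta_{k-1}}=F^i_{\theta_{k-1}}(k)$. For example, $M^0_{\theta_{k-1}}$ is the object computed at step $k+d$. Products of matrices $\bar A_{\theta_j}$ are ordered with later times on the left, e.g. $\prod_{j=1}^{d}\bar A_{\theta_{k-j}}=\bar A_{\theta_{k-1}}\cdots\bar A_{\theta_{k-d}}$ and $\prod_{s=0}^{i}\bar A_{\theta_{k-d+s}}=\bar A_{\theta_{k-d+i}}\cdots\bar A_{\theta_{k-d}}$. Empty products are $I$ and empty sums are $0$. **Recursion**, for $k=N,N-1,\dots,d$, with $\bar P_{\theta_N}(N+1)=\bar P_{N+1}$: $$\bar P_{\theta_{k-1}}(k)=Q+\mathbb E_{k-1}\big[\bar A_{\theta_k}'\bar P_{\theta_k}(k+1)\bar A_{\theta_k}-(M^0_{\theta_{k-1}})'\Gamma^{-1}_{\theta_{k-1}}M^0_{\theta_{k-1}}\big],$$ $$\Gamma_{\theta_{k-d-1}}=R+\mathbb E_{k-d-1}\Big[\bar B_{\theta_k}'\bar P_{\theta_k}(k+1)\bar B_{\theta_k}-\sum_{i=0}^{d-1}(M^{i+1}_{\theta_{k-d+i}})'\Gamma^{-1}_{\theta_{k-d+i}}M^{i+1}_{\theta_{k-d+i}}\Big],$$ $$\tilde S^1_{\theta_{k-1}}=\mathbb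 E_{k-1}\big[\bar A_{\theta_k}'\bar P_{\theta_k}(k+1)\bar B_{\theta_k}\big],$$ $$M^0_{\theta_{k-d-1}}=\mathbb E_{k-d-1}\Big[(\tilde S^1_{\theta_{k-1}})'\prod_{j=1}^{d}\bar A_{\theta_{k-j}}-\sum_{i=0}^{d-1}(M^{i+1}_{\theta_{k-d+i}})'\Gamma^{-1}_{\theta_{k-d+i}}M^0_{\theta_{k-d+i}}\prod_{s=0}^{i}\bar A_{\theta_{k-d+s}}\Big],$$ $$M^i_{\theta_{k-d-1}}=\mathbb E_{k-d-1}\Big[(\tilde S^1_{\theta_{k-1}})'\Big(\prod_{j=1}^{i-1}\bar A_{\theta_{k-j}}\Big)\bar B_{\theta_{k-i}}-\sum_{s=0}^{d-1}(M^{s+1}_{\theta_{k-d+s}})'\Gamma^{-1}_{\theta_{k-d+s}}M^{i+s+1}_{\theta_{k-d+s}}\Big],\quad i=1,\dots,d,$$ $$M^i_{\theta_{k-d-1}}=M^0_{\theta_{k-d-1}}\,\mathbb E_{k-d-1}\Big[\Big(\prod_{j=1}^{i-d-1}\bar A_{\theta_{k-d-j}}\Big)\bar B_{\theta_{k-i}}\Big],\quad i\ge d+1,\ i\le k,$$ $$M^i_{\theta_{N-s-1}}=0\quad\text{for } i\ge 0,\ s\le d-1.$$ Every term containing a factor $M^i_{\theta_j}$ with $j\ge N-d$ is read as $0$, so no $\Gamma_{\theta_j}$ with $j\ge N-d$ is needed. The step $k$ objects are defined as long as the matrices $\Gamma$ from the previously computed steps $k+1,\dots,N$ are invertible. The condition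 ''$\Gamma_{\theta_{k-d-1}}$ is positive definite for every $k=N,\dots,d$'' means that the backward recursion runs through all these steps with every such $\Gamma$ positive definite. **The matrices $F^i$** (of size $(n+m)\times m$), for $d\le k\le N$: $$F^1_{\theta_{k-1}}=\tilde S^1_{\theta_{k-1}}-\sum_{i=0}^{d-1}F^{i+2}_{\theta_{k-1}}\Gamma^{-1}_{\theta_{k-d+i}}M^{i+1}_{\theta_{k-d+i}},\qquad F^i_{\theta_{k-1}}=\mathbb E_{k-1}\big[\bar A_{\theta_k}'F^{i-1}_{\theta_k}\big]\quad (i\ge 2,\ k+i-1\le N).$$ The $F^i_{\theta_{k-1}}$ with $k+i-1>N$ only occur multiplied by vanishing $M$-terms, and such terms are read as $0$. *)

(* Defs.v *)
From HB Require Import structures.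
From mathcomp Require Export all_boot all_order all_algebra.
From mathcomp Require Export all_classical all_reals all_analysis.
From mathcomp Require Import zify.

Set Implicit Arguments.
Unset Strict Implicit.
Unset Printing Implicit Defensive.

Import Order.TTheory GRing.Theory Num.Theory.

Local Open Scope classical_set_scope.
Local Open Scope ring_scope.

Section QuadraticForms.
Context {R : realType} {p : nat}.

Definition qform (W : 'M[R]_p) (x : 'cV[R]_p) : R := (x^T *m W *m x) ord0 ord0.

Definition possemidefmx (W : 'M[R]_p) : Prop :=
  W^T = W /\ forall x, 0 <= qform W x.

Definition posdefmx (W : 'M[R]_p) : Prop :=
  W^T = W /\ forall x, x != 0 -> 0 < qform W x.

End QuadraticForms.

Section ConditionalExpectation.
Context {disp : measure_display} {T : measurableType disp} {R : realType}.

Definition sub_measurable (G : set_system T) (X : T -> R) : Prop :=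
  preimage_set_system setT X measurable `<=` G.

Definition sub_measurable_mx (G : set_system T) p q
    (X : T -> 'M[R]_(p, q)) : Prop :=
  forall i j, sub_measurable G (fun w => X w i j).

Variable P : probability T R.

Definition is_cond_exp (G : set_system T) (X Y : T -> R) : Prop :=
  [/\ sub_measurable G Y, P.-integrable setT (EFin \o Y) &
      forall A, G A -> (\int[P]_(w in A) (Y w)%:E = \int[P]_(w in A) (X w)%:E)%E].

(* An arbitrary version of E[X | G]: versions agree almost surely only. *)
Definition cond_exp (G : set_system T) (X : T -> R) : T -> R :=
  xget (cst 0) [set Y | is_cond_exp G X Y].

Definition cond_exp_mx (G : set_system T) p q (X : T -> 'M[R]_(p, q)) :
    T -> 'M[R]_(p, q) :=
  fun w => \matrix_(i, j) cond_exp G (fun w' => X w' i j) w.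

End ConditionalExpectation.

Section Chain.
Context {disp : measure_display} {T : measurableType disp} {R : realType}.
Variables (P : probability T R) (theta : nat -> {RV P >-> bool}).

Definition is_markov_chain (xi : bool -> bool -> R) : Prop :=
  [/\ forall i j, 0 <= xi i j,
      forall i, xi i false + xi i true = 1 &
      forall (k : nat) (h : nat -> bool) (j : bool),
        let past := [set w | forall i, (i <= k)%N -> theta i w = h i] in
        P (past `&` [set w | theta k.+1 w = j]) = ((xi (h k) j)%:E * P past)%E].

(* The sigma-algebra generated by theta_0, ..., theta_(k-1).  The index is
   shifted by one with respect to the usual F_k, so that past 0 is the trivial
   sigma-algebra F_(-1). *)
Definition past (k : nat) : set_system T :=
  <<s \bigcup_(i in `I_k) preimage_set_system setT (theta i) measurable >>.

(* E_(k-1) *)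
Definition Epast (k : nat) p q (X : T -> 'M[R]_(p, q)) : T -> 'M[R]_(p, q) :=
  cond_exp_mx P (past k) X.

End Chain.

Section Model.
Context {disp : measure_display} {T : measurableType disp} {R : realType}.
Context {n m : nat}.
Variables (P : probability T R) (theta : nat -> {RV P >-> bool}).
Variables (A : 'M[R]_n) (B : 'M[R]_(n, m)).

Definition Abar (t : bool) : 'M[R]_(n + m) :=
  block_mx A ((1 - t%:R) *: B) 0 (1 - t%:R)%:M.

Definition Bbar (t : bool) : 'M[R]_(n + m, m) :=
  col_mx (t%:R *: B) t%:R%:M.

(* Abar_(theta_(b-1)) ... Abar_(theta_a), the identity when b <= a *)
Definition Aprod (a b : nat) (w : T) : 'M[R]_(n + m) :=
  \big[mulmx/1%:M]_(t <- rev (index_iota a b)) Abar (theta t w).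

(* Throughout, v k stands for the delayed control u^c_(k-d). *)
Fixpoint state (z0 : 'cV[R]_(n + m)) (v : nat -> T -> 'cV[R]_m) (k : nat)
    (w : T) : 'cV[R]_(n + m) :=
  if k is j.+1 then
    Abar (theta j w) *m state z0 v j w + Bbar (theta j w) *m v j w
  else z0.

Variables (Q : 'M[R]_(n + m)) (Rw : 'M[R]_m) (PN1 : 'M[R]_(n + m)).
Variables (d N : nat).

(* uinit i is the initial datum u^c_(i-d). *)
Definition admissible (uinit : 'I_d -> 'cV[R]_m) (v : nat -> T -> 'cV[R]_m) :
    Prop :=
  (forall (i : 'I_d) w, v i w = uinit i) /\
  (forall k, (d <= k <= N)%N -> sub_measurable_mx (past theta (k - d)) (v k)).

Definition cost (z0 : 'cV[R]_(n + m)) (v : nat -> T -> 'cV[R]_m) : \bar R :=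
  'E_P[fun w => \sum_(0 <= k < N.+1)
                  (qform Q (state z0 v k w) + qform Rw (v k w))
                + qform PN1 (state z0 v N.+1 w)].

Definition optimal (z0 : 'cV[R]_(n + m)) (uinit : 'I_d -> 'cV[R]_m)
    (v : nat -> T -> 'cV[R]_m) : Prop :=
  admissible uinit v /\
  forall v', admissible uinit v' -> (cost z0 v <= cost z0 v')%E.

Definition has_unique_solution (z0 : 'cV[R]_(n + m))
    (uinit : 'I_d -> 'cV[R]_m) : Prop :=
  (exists v, optimal z0 uinit v) /\
  (forall v v', optimal z0 uinit v -> optimal z0 uinit v' ->
     forall k, (d <= k <= N)%N -> {ae P, forall w, v k w = v' k w}).

(* lam k stands for lambda_(k-1). *)
Definition fbsde_solution (z0 : 'cV[R]_(n + m)) (uinit : 'I_d -> 'cV[R]_m)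
    (v : nat -> T -> 'cV[R]_m) (lam : nat -> T -> 'cV[R]_(n + m)) : Prop :=
  [/\ admissible uinit v,
      forall k, (d <= k <= N.+1)%N -> sub_measurable_mx (past theta k) (lam k),
      forall k, (d <= k <= N)%N -> {ae P, forall w,
        0 = Epast theta (k - d)
              (fun w' => (Bbar (theta k w'))^T *m lam k.+1 w') w
            + Rw *m v k w},
      forall k, (d <= k <= N)%N -> {ae P, forall w,
        lam k w = Q *m state z0 v k w
            + Epast theta k
                (fun w' => (Abar (theta k w'))^T *m lam k.+1 w') w} &
      {ae P, forall w, lam N.+1 w = PN1 *m state z0 v N.+1 w}].

(* The objects computed at one step k of the recursion: Pbar_(theta_(k-1)),
   Gamma_(theta_(k-d-1)), M^0_(theta_(k-d-1)) and, for i >= 1,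
   M^i_(theta_(k-d-1)); M^0 is kept apart because it has another shape.  An
   object with subscript theta_j is thus found at step j+1 for Pbar, and at
   step j+d+1 for Gamma and M^i. *)
Record stage := Stage {
  stP : T -> 'M[R]_(n + m);
  stG : T -> 'M[R]_m;
  stM0 : T -> 'M[R]_(m, n + m);
  stM : nat -> T -> 'M[R]_m }.

(* Beyond the horizon, M^i vanishes and the value of Gamma is irrelevant. *)
Definition stage_end : stage :=
  Stage (fun=> PN1) (fun=> 0) (fun=> 0) (fun _ _ => 0).

Definition next_S (t : nat -> stage) (k : nat) : T -> 'M[R]_(n + m, m) :=
  Epast theta k (fun w =>
    (Abar (theta k w))^T *m stP (t k.+1) w *m Bbar (theta k w)).

Definition next_G (t : nat -> stage) (k : nat) : T -> 'M[R]_m := fun w =>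
  Rw + Epast theta (k - d) (fun w =>
    (Bbar (theta k w))^T *m stP (t k.+1) w *m Bbar (theta k w)
    - \sum_(0 <= i < d)
        (stM (t (k + i.+1)%N) i.+1 w)^T *m invmx (stG (t (k + i.+1)%N) w)
        *m stM (t (k + i.+1)%N) i.+1 w) w.

Definition next_M0 (t : nat -> stage) (k : nat) : T -> 'M[R]_(m, n + m) :=
  Epast theta (k - d) (fun w =>
    (next_S t k w)^T *m Aprod (k - d) k w
    - \sum_(0 <= i < d)
        (stM (t (k + i.+1)%N) i.+1 w)^T *m invmx (stG (t (k + i.+1)%N) w)
        *m stM0 (t (k + i.+1)%N) w *m Aprod (k - d) (k - d + i).+1 w).

(* Only meaningful for 1 <= i <= k. *)
Definition next_M (t : nat -> stage) (k i : nat) : T -> 'M[R]_m :=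
  if (i <= d)%N then
    Epast theta (k - d) (fun w =>
      (next_S t k w)^T *m Aprod (k - i).+1 k w *m Bbar (theta (k - i)%N w)
      - \sum_(0 <= s < d)
          (stM (t (k + s.+1)%N) s.+1 w)^T *m invmx (stG (t (k + s.+1)%N) w)
          *m stM (t (k + s.+1)%N) (i + s.+1)%N w)
  else fun w =>
    next_M0 t k w *m
      Epast theta (k - d) (fun w =>
        Aprod (k - i).+1 (k - d) w *m Bbar (theta (k - i)%N w)) w.

(* Here t already holds Gamma and M^0 of step k, needed when d = 0. *)
Definition next_P (t : nat -> stage) (k : nat) : T -> 'M[R]_(n + m) := fun w =>
  Q + Epast theta k (fun w =>
    (Abar (theta k w))^T *m stP (t k.+1) w *m Abar (theta k w)
    - (stM0 (t (k + d)%N) w)^T *m invmx (stG (t (k + d)%N) w)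
      *m stM0 (t (k + d)%N) w) w.

Definition set_stage (t : nat -> stage) (k : nat) (s : stage) : nat -> stage :=
  fun j => if j == k then s else t j.

Definition next_table (t : nat -> stage) (k : nat) : nat -> stage :=
  let G := next_G t k in
  let M0 := next_M0 t k in
  let M := next_M t k in
  let t' := set_stage t k (Stage (fun=> 0) G M0 M) in
  set_stage t k (Stage (next_P t' k) G M0 M).

(* The steps N, N-1, ..., N-r+1.  As invmx is total, the recursion never stops;
   what it computes after a singular Gamma plays no role, since positive
   definiteness of every Gamma has then already failed. *)
Fixpoint backward (r : nat) : nat -> stage :=
  if r is r'.+1 then next_table (backward r') (N - r') else fun=> stage_end.

Definition recursion : nat -> stage := backward (N.+1 - d).

(* All of the following are indexed by the step k of the recursion. *)
Definition Pbar (k : nat) := stP (recursion k).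
Definition Gamma (k : nat) := stG (recursion k).
Definition M0 (k : nat) := stM0 (recursion k).
Definition M (k i : nat) := stM (recursion k) i.
Definition Stilde (k : nat) : T -> 'M[R]_(n + m, m) := next_S recursion k.

(* The matrices F^i, i >= 1, of step N+1-r; they are 0 beyond the horizon, so
   that F^i of step k vanishes almost surely when k + i - 1 > N. *)
Fixpoint Fback (r : nat) : nat -> T -> 'M[R]_(n + m, m) :=
  if r is r'.+1 then
    let k := (N - r')%N in
    let shift i := Epast theta k (fun w =>
      (Abar (theta k w))^T *m Fback r' i w) in
    fun i => if i == 1%N then fun w =>
        Stilde k w - \sum_(0 <= j < d)
          shift j.+1 w *m invmx (Gamma (k + j.+1) w) *m M (k + j.+1) j.+1 w
      else shift i.-1
  else fun _ _ => 0.

Definition Fmx (k i : nat) : T -> 'M[R]_(n + m, m) := Fback (N.+1 - k) i.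

Section RecursionEquations.

Let backward_out r k : (k + r <= N)%N \/ (N < k)%N -> (r <= N.+1)%N ->
  backward r k = stage_end.
Proof.
elim: r => [//|r IH] hk hr /=; rewrite /next_table /set_stage.
case: eqP => [kE|_]; last by apply: IH; [case: hk => ?; [left|right]; lia|lia].
by exfalso; case: hk => ?; lia.
Qed.

Let backward_stable r r' k : (N < k + r)%N -> (r <= r' <= N.+1)%N ->
  backward r' k = backward r k.
Proof.
elim: r' => [|r' IH] hk hr; first by have -> : r = 0%N by lia.
have [->//|neq] := eqVneq r r'.+1.
rewrite /= /next_table /set_stage; case: eqP => [kE|_]; first by lia.
by apply: IH; lia.
Qed.

Let recursion_next k : (d <= k <= N)%N ->
  recursion k = next_table (backward (N - k)) k k.
Proof.
move=> hk; rewrite /recursion (@backward_stable (N - k).+1); try lia.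
by rewrite /= subKn //; lia.
Qed.

Let recursion_later k j : (d <= k <= N)%N -> (k < j)%N ->
  backward (N - k) j = recursion j.
Proof.
move=> hk kj; rewrite /recursion; apply/esym.
by apply: backward_stable; lia.
Qed.

Lemma recursion_end k : (N < k)%N -> recursion k = stage_end.
Proof. by move=> hk; apply: backward_out; [right|lia]. Qed.

Lemma StildeE k : Stilde k = Epast theta k (fun w =>
    (Abar (theta k w))^T *m Pbar k.+1 w *m Bbar (theta k w)).
Proof. by []. Qed.

Let next_SE k : (d <= k <= N)%N -> next_S (backward (N - k)) k = Stilde k.
Proof. by move=> hk; rewrite /Stilde /next_S recursion_later. Qed.

Lemma GammaE k : (d <= k <= N)%N -> Gamma k = fun w =>
  Rw + Epast theta (k - d) (fun w =>
    (Bbar (theta k w))^T *m Pbar k.+1 w *m Bbar (theta k w)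
    - \sum_(0 <= i < d) (M (k + i.+1) i.+1 w)^T
        *m invmx (Gamma (k + i.+1) w) *m M (k + i.+1) i.+1 w) w.
Proof.
move=> hk; rewrite {1}/Gamma recursion_next // /next_table /set_stage eqxx /=.
rewrite /next_G; apply/funext => w; congr (_ + Epast _ _ _ w).
apply/funext => w'; rewrite recursion_later //; congr (_ - _).
by apply: eq_bigr => i _; rewrite recursion_later //; lia.
Qed.

Let next_M0E k : (d <= k <= N)%N -> next_M0 (backward (N - k)) k = M0 k.
Proof.
by move=> hk; rewrite /M0 recursion_next // /next_table /set_stage eqxx.
Qed.

Lemma M0E k : (d <= k <= N)%N -> M0 k = Epast theta (k - d) (fun w =>
    (Stilde k w)^T *m Aprod (k - d) k w
    - \sum_(0 <= i < d) (M (k + i.+1) i.+1 w)^T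
        *m invmx (Gamma (k + i.+1) w) *m M0 (k + i.+1) w
        *m Aprod (k - d) (k - d + i).+1 w).
Proof.
move=> hk; apply: (etrans (esym (next_M0E hk))); congr (Epast _ _ _).
apply/funext => w'; rewrite next_SE //; congr (_ - _).
by apply: eq_bigr => i _; rewrite recursion_later //; lia.
Qed.

Lemma M_leE k i : (d <= k <= N)%N -> (1 <= i <= d)%N ->
  M k i = Epast theta (k - d) (fun w =>
    (Stilde k w)^T *m Aprod (k - i).+1 k w *m Bbar (theta (k - i)%N w)
    - \sum_(0 <= s < d) (M (k + s.+1) s.+1 w)^T
        *m invmx (Gamma (k + s.+1) w) *m M (k + s.+1) (i + s.+1) w).
Proof.
move=> hk /andP[_ id].
rewrite {1}/M recursion_next // /next_table /set_stage eqxx /= /next_M id.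
congr (Epast _ _ _).
apply/funext => w'; rewrite next_SE //; congr (_ - _).
by apply: eq_bigr => s _; rewrite recursion_later //; lia.
Qed.

Lemma M_gtE k i : (d <= k <= N)%N -> (d < i <= k)%N ->
  M k i = fun w => M0 k w *m Epast theta (k - d) (fun w =>
    Aprod (k - i).+1 (k - d) w *m Bbar (theta (k - i)%N w)) w.
Proof.
move=> hk /andP[di _].
rewrite {1}/M recursion_next // /next_table /set_stage eqxx /= /next_M.
by rewrite leqNgt di /= next_M0E.
Qed.

Lemma PbarE k : (d <= k <= N)%N -> Pbar k = fun w =>
  Q + Epast theta k (fun w =>
    (Abar (theta k w))^T *m Pbar k.+1 w *m Abar (theta k w)
    - (M0 (k + d) w)^T *m invmx (Gamma (k + d) w) *m M0 (k + d) w) w.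
Proof.
move=> hk; rewrite {1}/Pbar recursion_next // {1}/next_table.
rewrite {1}/set_stage eqxx /=.
rewrite /next_P; apply/funext => w; congr (_ + Epast _ _ _ w).
apply/funext => w'; rewrite /set_stage; congr (_ - _).
  by case: eqP => [|_]; [lia | rewrite recursion_later].
rewrite /M0 /Gamma; case: eqP => [kdE|kd] /=.
  by rewrite kdE recursion_next // /next_table /set_stage eqxx.
by rewrite recursion_later //; lia.
Qed.

Lemma PbarN : Pbar N.+1 = fun=> PN1.
Proof. by rewrite /Pbar recursion_end. Qed.

Lemma M0_end k : (N < k)%N -> M0 k = fun=> 0.
Proof. by move=> hk; rewrite /M0 recursion_end. Qed.

Lemma M_end k i : (N < k)%N -> M k i = fun=> 0.
Proof. by move=> hk; rewrite /M recursion_end. Qed.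

Lemma Fmx_geE k i : (k <= N)%N -> (2 <= i)%N ->
  Fmx k i = Epast theta k (fun w => (Abar (theta k w))^T *m Fmx k.+1 i.-1 w).
Proof.
move=> hk hi; rewrite /Fmx subSn // subSS /= subKn //.
by case: eqP => // iE; lia.
Qed.

Lemma Fmx1E k : (k <= N)%N -> Fmx k 1 = fun w =>
  Stilde k w - \sum_(0 <= i < d)
    Fmx k i.+2 w *m invmx (Gamma (k + i.+1) w) *m M (k + i.+1) i.+1 w.
Proof.
move=> hk; apply/funext => w; rewrite {1}/Fmx subSn //= subKn //.
congr (_ - _); apply: eq_bigr => i _.
by rewrite Fmx_geE // /Fmx subSS.
Qed.

End RecursionEquations.

End Model.

(* Main.v *)
Require Import Defs.
From mathcomp Require Import all_boot all_order all_algebra.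
From mathcomp Require Import all_classical all_reals all_analysis.
From mathcomp Require Import zify lra ring.
Import Order.TTheory GRing.Theory Num.Theory.
Set Implicit Arguments.
Unset Strict Implicit.
Unset Printing Implicit Defensive.
Local Open Scope classical_set_scope.
Local Open Scope ring_scope.

(** The sigma-algebras of the past are generated by finitely many bits.  A function
that is measurable with respect to one of them is a function of these bits, and
after the horizon is fixed everything happens on the finite set of paths of
[theta] that have positive probability ([scenario]).  There a conditional
expectation is a weighted average, [condE], and an almost sure equality is an
equality everywhere ([cond_exp_path], [ae_path]).  Controls, costs, the backward
recursion and the forward-backward equations all transfer ([riccati_path],
[optimal_path], [fbsde_path]), and controls can be lifted back ([path_lift]).

On the finite space, the cost is a convex quadratic function of the control.  If
[lam] is the costate of [v], then summation by parts ([duality]) gives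
  J(v + x) = J(v) + 2 * (pairing of x with the gradient of v) + J0(x),
where J0 is the cost for zero initial data ([fcost_variation]).  As J0 is
nonnegative, optimality of [v] is the same as the vanishing of the gradient
([opt_stationary], [stationary_opt]), which is the forward-backward system.

The system is decoupled by a closed form for the costate.  The matrices of the
recursion are adjoints of the dynamics applied to F^1: the transpose of M^0 at
step k is the conditional expectation of (A ... A)' F^1, the one of M^i is the
conditional expectation of (A ... A B)' F^1 ([M0_adjoint], [M_adjoint]).  Hence,
if the costate at step k + 1 has the closed form, then the gradient at step k
equals Gamma v + drift ([gradient_closed]); and if the control of step k makes it
vanish, then the costate at step k has the closed form as well
([costate_closed]).  When each Gamma is positive definite, backward induction
identifies the stationary controls with those of the feedback law
([stationary_law]).  The feedback law has exactly one solution ([law_ex],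
[law_unique]), so there is exactly one optimal control, and [duality] reads off
its cost from the state and the costate at step d ([fopt_cost]).

Conversely, suppose that the optimal control is unique and that Gamma is positive
definite after step k but not at step k.  Choose a path and a nonzero vector x
with x' Gamma x <= 0, use x as control of step k on the paths that the controller
cannot distinguish from that one, zero before, and the feedback law
afterwards.  The cost J0 of this control is the expectation of x' Gamma x, so it
is zero, and adding the control to an optimal one produces another optimal one
([unique_posdef]). *)

(** * Adapted functions *)

Section Adapted.
Context {U : Type} (th : nat -> U -> bool).

Definition agree (k : nat) (w w' : U) : bool :=
  [forall i : 'I_k, th i w == th i w'].

(** A set belongs to the sigma-algebra generated by the first [k] bits if and
    only if it is saturated for [agree k] ([past_adapted], [adapted_past]), so that
    this pointwise condition is measurability with respect to it. *)
Definition adapted (V : Type) (k : nat) (X : U -> V) : Prop :=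
  forall w w', agree k w w' -> X w = X w'.

Lemma agreeP k w w' :
  reflect (forall i, (i < k)%N -> th i w = th i w') (agree k w w').
Proof.
apply: (iffP forallP) => [h i ik|h i]; last by apply/eqP/h.
by have /eqP := h (Ordinal ik).
Qed.

Lemma agree_refl k w : agree k w w.
Proof. by apply/agreeP. Qed.

Lemma agree_sym k w w' : agree k w w' = agree k w' w.
Proof. by apply/agreeP/agreeP => h i /h. Qed.

Lemma agree_trans k w1 w2 w3 : agree k w1 w2 -> agree k w2 w3 -> agree k w1 w3.
Proof.
by move=> /agreeP h /agreeP h'; apply/agreeP => i ik; rewrite h // h'.
Qed.

Lemma agree_le j k w w' : (j <= k)%N -> agree k w w' -> agree j w w'.
Proof.
by move=> jk /agreeP h; apply/agreeP => i ij; apply/h/(leq_trans ij).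
Qed.

Lemma agree_eqr k w w' : agree k w w' -> agree k w =1 agree k w'.
Proof.
move=> h w2; apply/idP/idP; apply: agree_trans => //.
by rewrite agree_sym.
Qed.

Lemma adapted_le (V : Type) j k (X : U -> V) :
  adapted j X -> (j <= k)%N -> adapted k X.
Proof. by move=> hX jk w w' /(agree_le jk)/hX. Qed.

Lemma adapted1 (V W : Type) (f : V -> W) k X :
  adapted k X -> adapted k (fun w => f (X w)).
Proof. by move=> h w w' /h ->. Qed.

Lemma adapted2 (V V' W : Type) (f : V -> V' -> W) k X X' :
  adapted k X -> adapted k X' -> adapted k (fun w => f (X w) (X' w)).
Proof. by move=> h h' w w' e; rewrite (h _ _ e) (h' _ _ e). Qed.

Lemma adapted_bigop (V : Type) (op : V -> V -> V) (idx : V) (I : eqType)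
    (r : seq I) k (X : I -> U -> V) :
  (forall i, i \in r -> adapted k (X i)) ->
  adapted k (fun w => \big[op/idx]_(i <- r) X i w).
Proof.
move=> h w w' e; rewrite [LHS]big_seq_cond [RHS]big_seq_cond.
by apply: eq_bigr => i /andP[ir _]; apply: h.
Qed.

End Adapted.

(** * Conditional expectation over a finite set of paths *)

Section FiniteExpectation.
Context {R : realType} {H : finType}.
Variables (p : H -> R) (th : nat -> H -> bool).

Definition mean (V : lmodType R) (X : H -> V) : V := \sum_h p h *: X h.

Definition weight (k : nat) (h : H) : R := \sum_(h' | agree th k h h') p h'.

(** Conditional expectation given the first [k] bits.  Being a finite sum it is
    linear on all functions, without integrability conditions. *)
Definition condE (k : nat) (V : lmodType R) (X : H -> V) (h : H) : V :=
  (weight k h)^-1 *: \sum_(h' | agree th k h h') p h' *: X h'.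

Hypothesis p_gt0 : forall h, 0 < p h.

Lemma weight_gt0 k h : 0 < weight k h.
Proof.
rewrite /weight (bigD1 h) /=; last exact: agree_refl.
by apply: ltr_pwDl => //; apply: sumr_ge0 => h' _; apply: ltW.
Qed.

Let weight_neq0 k h : weight k h != 0.
Proof. by rewrite gt_eqF // weight_gt0. Qed.

Lemma weight_agree k h h' : agree th k h h' -> weight k h = weight k h'.
Proof. by move=> e; apply: eq_bigl; apply: agree_eqr. Qed.

Section Module.
Context {V : lmodType R}.
Implicit Types X Y : H -> V.

Lemma meanD X Y : mean (fun h => X h + Y h) = mean X + mean Y.
Proof. by rewrite -big_split; apply: eq_bigr => h _; rewrite scalerDr. Qed.

Lemma mean_sum (I : Type) (r : seq I) (X : I -> H -> V) :
  mean (fun h => \sum_(i <- r) X i h) = \sum_(i <- r) mean (X i).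
Proof.
by rewrite exchange_big; apply: eq_bigr => h _; rewrite scaler_sumr.
Qed.

Lemma condE_adapted k X : adapted th k (condE k X).
Proof.
move=> h h' e; rewrite /condE (weight_agree e); congr (_ *: _).
by apply: eq_bigl; apply: agree_eqr.
Qed.

Lemma condED k X Y h :
  condE k (fun h => X h + Y h) h = condE k X h + condE k Y h.
Proof.
rewrite -scalerDr -big_split; congr (_ *: _).
by apply: eq_bigr => h' _; rewrite scalerDr.
Qed.

Lemma condEN k X h : condE k (fun h => - X h) h = - condE k X h.
Proof.
rewrite -scalerN -sumrN; congr (_ *: _).
by apply: eq_bigr => h' _; rewrite scalerN.
Qed.

Lemma condEB k X Y h :
  condE k (fun h => X h - Y h) h = condE k X h - condE k Y h.
Proof. by rewrite condED condEN. Qed.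

Lemma condE_sum (I : Type) (r : seq I) (X : I -> H -> V) k h :
  condE k (fun h => \sum_(i <- r) X i h) h = \sum_(i <- r) condE k (X i) h.
Proof.
rewrite -scaler_sumr exchange_big; congr (_ *: _).
by apply: eq_bigr => h' _; rewrite scaler_sumr.
Qed.

Lemma condE_id k X h : adapted th k X -> condE k X h = X h.
Proof.
move=> hX; rewrite /condE (eq_bigr (fun h' => p h' *: X h)).
  by rewrite -scaler_suml scalerA mulVf ?scale1r.
by move=> h' e; rewrite (hX _ _ e).
Qed.

(** After exchange of the sums, the value at [h'] is multiplied by the sum of
    [p i / weight k i] over the class of [h'], in which [weight k] is constant. *)
Lemma condE_tower j k X h : (j <= k)%N ->
  condE j (condE k X) h = condE j X h.
Proof.
move=> jk; congr (_ *: _).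
under eq_bigr do rewrite scalerA scaler_sumr.
rewrite (exchange_big_dep (agree th j h)) /=.
  apply: eq_bigr => h' hh'.
  rewrite (eq_bigr (fun i => ((weight k h')^-1 * p i) *: (p h' *: X h'))).
    rewrite -scaler_suml -mulr_sumr.
    rewrite (eq_bigl (agree th k h')); last first.
      move=> i; rewrite [agree th k i h']agree_sym.
      apply/andP/idP => [[]//|h'i]; split=> //.
      by apply: agree_trans hh' _; apply: agree_le h'i.
    by rewrite mulVf ?scale1r //; exact: weight_neq0.
  by move=> i /andP[_ e]; rewrite (weight_agree e) mulrC.
by move=> i i' hi ii'; apply: agree_trans hi (agree_le jk ii').
Qed.

Lemma mean_condE k X : mean (condE k X) = mean X.
Proof.
rewrite /mean; under eq_bigr do rewrite scalerA scaler_sumr.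
rewrite (exchange_big_dep predT) //=.
apply: eq_bigr => h' _.
rewrite (eq_bigr (fun i => ((weight k h')^-1 * p i) *: (p h' *: X h'))).
  rewrite -scaler_suml -mulr_sumr.
  under eq_bigl do rewrite agree_sym.
  by rewrite mulVf ?scale1r //; exact: weight_neq0.
by move=> i ii; rewrite (weight_agree ii) mulrC.
Qed.

End Module.

Lemma condE_mull k m n q (C : H -> 'M[R]_(m, n)) (X : H -> 'M[R]_(n, q)) h :
  adapted th k C -> condE k (fun h => C h *m X h) h = C h *m condE k X h.
Proof.
move=> hC; rewrite -scalemxAr mulmx_sumr; congr (_ *: _).
by apply: eq_bigr => h' e; rewrite (hC _ _ e) scalemxAr.
Qed.

Lemma condE_mulr k m n q (X : H -> 'M[R]_(m, n)) (C : H -> 'M[R]_(n, q)) h :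
  adapted th k C -> condE k (fun h => X h *m C h) h = condE k X h *m C h.
Proof.
move=> hC; rewrite -scalemxAl mulmx_suml; congr (_ *: _).
by apply: eq_bigr => h' e; rewrite (hC _ _ e) scalemxAl.
Qed.

Lemma condE_tr k m n (X : H -> 'M[R]_(m, n)) h :
  condE k (fun h => (X h)^T) h = (condE k X h)^T.
Proof.
rewrite linearZ /=; congr (_ *: _); rewrite linear_sum /=.
by apply: eq_bigr => h' _; rewrite linearZ.
Qed.

Lemma mean_ge0 (X : H -> R^o) : (forall h, 0 <= X h) -> 0 <= mean X.
Proof. by move=> hX; apply: sumr_ge0 => h _; rewrite mulr_ge0 // ltW. Qed.

End FiniteExpectation.

(** * Trajectories and pairings *)

(** Turns sums over times into sums over delays. *)
Lemma sum_nat_down (V : nmodType) (f : nat -> V) (r k : nat) : (r <= k)%N ->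
  \sum_(k - r <= j < k) f j = \sum_(1 <= i < r.+1) f (k - i)%N.
Proof.
elim: r => [|r IH] rk; first by rewrite subn0 !big_geq.
rewrite big_nat_recr //= -IH; last by lia.
rewrite big_ltn; last by lia.
by rewrite addrC; congr (_ + _); congr bigop; congr index_iota; lia.
Qed.

Section Trajectory.
Context {R : realType} {U : Type} {q m : nat}.
Variables (a : nat -> U -> 'M[R]_q) (b : nat -> U -> 'M[R]_(q, m)).

Fixpoint traj (z0 : 'cV[R]_q) (v : nat -> U -> 'cV[R]_m) (k : nat) (h : U) :
    'cV[R]_q :=
  if k is j.+1 then a j h *m traj z0 v j h + b j h *m v j h else z0.

Definition aprod (i j : nat) (h : U) : 'M[R]_q :=
  \big[mulmx/1%:M]_(t <- rev (index_iota i j)) a t h.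

Lemma aprod_geq i j h : (j <= i)%N -> aprod i j h = 1%:M.
Proof. by move=> ji; rewrite /aprod /index_iota (eqP ji) big_nil. Qed.

Lemma aprod_recr i j h : (i <= j)%N ->
  aprod i j.+1 h = a j h *m aprod i j h.
Proof.
move=> ij; rewrite /aprod /index_iota subSn // -addn1 iotaD /= cats1.
by rewrite rev_rcons big_cons subnKC.
Qed.

Lemma aprod_cat i j k h : (i <= j <= k)%N ->
  aprod i k h = aprod j k h *m aprod i j h.
Proof.
elim: k => [|k IH] /andP[ij jk].
  by rewrite !aprod_geq ?mul1mx //; lia.
have [->|jk'] := eqVneq j k.+1; first by rewrite [aprod k.+1 _ _]aprod_geq // mul1mx.
by rewrite !aprod_recr ?IH ?mulmxA //; lia.
Qed.

Lemma aprod_recl i j h : (i < j)%N -> aprod i j h = aprod i.+1 j h *m a i h.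
Proof.
move=> ij; rewrite (@aprod_cat i i.+1) ?leqnSn //.
by rewrite aprod_recr // (@aprod_geq i i) // mulmx1.
Qed.

Lemma traj_ext z0 v v' k h : (forall j, (j < k)%N -> v j h = v' j h) ->
  traj z0 v k h = traj z0 v' k h.
Proof.
elim: k => [//|k IH] e /=; rewrite IH ?e // => j jk.
by apply: e; lia.
Qed.

Lemma trajB z0 v v' k h :
  traj z0 v' k h - traj z0 v k h = traj 0 (fun j h => v' j h - v j h) k h.
Proof.
elim: k => [|k IH] /=; first by rewrite subrr.
by rewrite -IH !mulmxBr opprD addrACA.
Qed.

Lemma traj0 v k h : (forall j, (j < k)%N -> v j h = 0) -> traj 0 v k h = 0.
Proof.
elim: k => [//|k IH] e /=; rewrite IH ?e ?mulmx0 ?addr0 // => j jk.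
by apply: e; lia.
Qed.

(** Variation of constants, started at time [i]. *)
Lemma traj_aprod z0 v i r h :
  traj z0 v (i + r)%N h = aprod i (i + r) h *m traj z0 v i h
    + \sum_(i <= j < i + r) aprod j.+1 (i + r) h *m b j h *m v j h.
Proof.
elim: r => [|r IH].
  by rewrite addn0 aprod_geq // mul1mx big_geq ?addr0.
rewrite addnS /= IH aprod_recr ?leq_addr // big_nat_recr ?leq_addr //=.
rewrite (@aprod_geq (i + r).+1) // mul1mx mulmxDr mulmxA -!addrA; congr (_ + _).
congr (_ + _); rewrite mulmx_sumr; apply: eq_big_nat => j jr.
by rewrite (@aprod_recr j.+1) ?mulmxA //; lia.
Qed.

End Trajectory.

Section Pairing.
Context {R : realType} {H : finType}.
Variables (p : H -> R) (th : nat -> H -> bool).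
Hypothesis p_gt0 : forall h, 0 < p h.

Definition dot r (x y : H -> 'cV[R]_r) : R :=
  mean p (fun h => (x h)^T *m y h) ord0 ord0.

Lemma dotE r (x y : H -> 'cV[R]_r) :
  dot x y = mean p (fun h => ((x h)^T *m y h) ord0 ord0 : R^o).
Proof.
rewrite /dot /mean summxE; apply: eq_bigr => h _.
by rewrite mxE.
Qed.

Lemma eq_dot r (x x' y y' : H -> 'cV[R]_r) : x =1 x' -> y =1 y' ->
  dot x y = dot x' y'.
Proof.
by move=> e e'; rewrite /dot; congr (fun_of_matrix (mean p _) _ _);
  apply/funext => h; rewrite e e'.
Qed.

Lemma dotC r (x y : H -> 'cV[R]_r) : dot x y = dot y x.
Proof.
rewrite !dotE; congr (mean p _); apply/funext => h.
have -> : (x h)^T *m y h = ((y h)^T *m x h)^T by rewrite trmx_mul trmxK.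
by rewrite mxE.
Qed.

Lemma dotDr r (x y y' : H -> 'cV[R]_r) :
  dot x (fun h => y h + y' h) = dot x y + dot x y'.
Proof.
rewrite !dotE -meanD; congr (mean p _); apply/funext => h.
by rewrite mulmxDr mxE.
Qed.

Lemma dotDl r (x x' y : H -> 'cV[R]_r) :
  dot (fun h => x h + x' h) y = dot x y + dot x' y.
Proof. by rewrite dotC dotDr ![dot y _]dotC. Qed.

Lemma dot0l r (x y : H -> 'cV[R]_r) : (forall h, x h = 0) -> dot x y = 0.
Proof.
move=> e; rewrite dotE /mean big1 // => h _.
by rewrite e trmx0 mul0mx mxE scaler0.
Qed.

Lemma dot0r r (x y : H -> 'cV[R]_r) : (forall h, y h = 0) -> dot x y = 0.
Proof. by move=> e; rewrite dotC dot0l. Qed.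

Lemma dotZl r (c : R) (x y : H -> 'cV[R]_r) :
  dot (fun h => c *: x h) y = c * dot x y.
Proof.
rewrite !dotE /mean mulr_sumr; apply: eq_bigr => h _.
rewrite linearZ /= -scalemxAl mxE [LHS]mulrCA; congr (_ * _).
Qed.

Lemma dot_mull r s (C : H -> 'M[R]_(r, s)) (x : H -> 'cV[R]_s) y :
  dot (fun h => C h *m x h) y = dot x (fun h => (C h)^T *m y h).
Proof.
by rewrite /dot; congr (fun_of_matrix (mean p _) _ _); apply/funext => h;
  rewrite trmx_mul mulmxA.
Qed.

Lemma dot_condE r k (x y : H -> 'cV[R]_r) : adapted th k x ->
  dot x (condE p th k y) = dot x y.
Proof.
move=> hx; rewrite /dot -(mean_condE th p_gt0 k (fun h => (x h)^T *m y h)).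
congr (fun_of_matrix (mean p _) _ _); apply/funext => h; rewrite condE_mull //;
  exact: adapted1.
Qed.

Lemma dot_qform r (W : 'M[R]_r) (x : H -> 'cV[R]_r) :
  dot x (fun h => W *m x h) = mean p (fun h => qform W (x h) : R^o).
Proof. by rewrite dotE; congr (mean p _); apply/funext => h; rewrite mulmxA. Qed.

Lemma dot_ge0 r (x : H -> 'cV[R]_r) : 0 <= dot x x.
Proof.
rewrite dotE; apply: mean_ge0 => // h.
by rewrite mxE sumr_ge0 // => i _; rewrite mxE -expr2 sqr_ge0.
Qed.

Lemma dot_eq0 r (x : H -> 'cV[R]_r) : dot x x = 0 -> forall h, x h = 0.
Proof.
have x2 h : 0 <= ((x h)^T *m x h) ord0 ord0.
  by rewrite mxE sumr_ge0 // => i _; rewrite mxE -expr2 sqr_ge0.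
move=> /eqP; rewrite dotE /mean psumr_eq0; last first.
  by move=> h _; rewrite mulr_ge0 // ltW.
move=> /allP e h; have := e h (mem_index_enum h) => /=.
rewrite mulf_eq0 gt_eqF //= mxE psumr_eq0; last first.
  by move=> i _; rewrite mxE -expr2 sqr_ge0.
move=> /allP e'; apply/matrixP => i j; rewrite ord1 mxE.
by have := e' i (mem_index_enum i); rewrite mxE mulf_eq0 orbb => /eqP.
Qed.

End Pairing.

(** * The variational structure of the control problem *)

Section Variation.
Context {R : realType} {H : finType} {q m : nat}.
Variables (p : H -> R) (th : nat -> H -> bool).
Variables (a : nat -> H -> 'M[R]_q) (b : nat -> H -> 'M[R]_(q, m)).
Variables (Q : 'M[R]_q) (Rw : 'M[R]_m) (PN1 : 'M[R]_q) (d N : nat).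

Local Notation E := (condE p th).
Local Notation Z := (traj a b).
Local Notation dot := (dot p).

(** The finite counterpart of [admissible]. *)
Definition causal (u0 : 'I_d -> 'cV[R]_m) (v : nat -> H -> 'cV[R]_m) : Prop :=
  (forall (i : 'I_d) h, v i h = u0 i) /\
  (forall k, (d <= k <= N)%N -> adapted th (k - d) (v k)).

Definition fcost (z0 : 'cV[R]_q) (v : nat -> H -> 'cV[R]_m) : R :=
  mean p (fun h => (\sum_(0 <= k < N.+1)
    (qform Q (Z z0 v k h) + qform Rw (v k h)) + qform PN1 (Z z0 v N.+1 h)) : R^o).

Definition costate (z0 : 'cV[R]_q) (v : nat -> H -> 'cV[R]_m)
    (lam : nat -> H -> 'cV[R]_q) : Prop :=
  (forall k h, (d <= k <= N)%N -> lam k h = Q *m Z z0 v k h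
     + E k (fun h => (a k h)^T *m lam k.+1 h) h) /\
  (forall h, lam N.+1 h = PN1 *m Z z0 v N.+1 h).

(** Half the derivative of the cost with respect to the control of step [k],
    see [fcost_variation]. *)
Definition gradient (v : nat -> H -> 'cV[R]_m) (lam : nat -> H -> 'cV[R]_q)
    (k : nat) (h : H) : 'cV[R]_m :=
  Rw *m v k h + E (k - d) (fun h => (b k h)^T *m lam k.+1 h) h.

Hypothesis p_gt0 : forall h, 0 < p h.
Hypothesis a_adapted : forall k, adapted th k.+1 (a k).
Hypothesis b_adapted : forall k, adapted th k.+1 (b k).
Hypothesis dN : (d <= N)%N.
Hypothesis Q_psd : possemidefmx Q.
Hypothesis Rw_psd : possemidefmx Rw.
Hypothesis PN1_psd : possemidefmx PN1.

Lemma causal_adapted u0 v j k : causal u0 v -> (j <= N)%N -> (j - d <= k)%N ->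
  adapted th k (v j).
Proof.
move=> [v0 va] jN jk; have [dj|jd] := leqP d j.
  by apply: adapted_le jk; apply: va; rewrite dj.
by move=> h h' _; rewrite (v0 (Ordinal jd) h) (v0 (Ordinal jd) h').
Qed.

Lemma traj_adapted u0 v z0 k : causal u0 v -> (k <= N.+1)%N ->
  adapted th k (Z z0 v k).
Proof.
move=> cv; elim: k => [//|k IH] kN /=.
apply: adapted2; apply: adapted2; first exact: a_adapted.
- by apply: adapted_le (IH _) _; lia.
- exact: b_adapted.
- by apply: (causal_adapted cv); lia.
Qed.

Lemma causalB u0 v v' : causal u0 v -> causal u0 v' ->
  causal (fun=> 0) (fun k h => v' k h - v k h).
Proof.
move=> [v0 va] [v0' va']; split=> [i h|k kN]; first by rewrite v0 v0' subrr.
by apply: adapted2; [exact: va' kN|exact: adapted1 (va _ kN)].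
Qed.

Lemma causalDZ u0 v x (e : R) : causal u0 v -> causal (fun=> 0) x ->
  causal u0 (fun k h => v k h + e *: x k h).
Proof.
move=> [v0 va] [x0 xa]; split=> [i h|k kN].
  by rewrite v0 x0 scaler0 addr0.
by move=> h h' hh'; rewrite (va _ kN _ _ hh') (xa _ kN _ _ hh').
Qed.

Lemma costate_ex z0 v : exists lam, costate z0 v lam.
Proof.
pose fix l r : H -> 'cV[R]_q := if r is r'.+1 then fun h =>
  Q *m Z z0 v (N - r') h + E (N - r') (fun h => (a (N - r')%N h)^T *m l r' h) h
  else fun h => PN1 *m Z z0 v N.+1 h.
exists (fun k => l (N.+1 - k)%N); split=> [k h /andP[_ kN]|h].
  by rewrite subSn //= subKn // subSS.
by rewrite subnn.
Qed.

Lemma costate_adapted u0 z0 v lam k : causal u0 v -> costate z0 v lam ->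
  (d <= k <= N.+1)%N -> adapted th k (lam k).
Proof.
move=> cv [lE lN] /andP[dk kN]; have tr W : adapted th k (fun h => W *m Z z0 v k h).
  by apply: adapted1; apply: traj_adapted cv kN.
have [kE|kN'] := eqVneq k N.+1.
  by move=> h h' e; rewrite kE !lN -kE (tr _ PN1 _ _ e).
move=> h h' e; rewrite !lE; [|by lia..].
by rewrite (tr _ Q _ _ e) (condE_adapted _ _ e).
Qed.

(** Summation by parts: in the difference of the pairings of [zeta] and [lam] at
    times [k + 1] and [k], the costate equation cancels the terms with [a k]. *)
Lemma duality z0 v lam zeta delta : costate z0 v lam ->
  (forall k h, zeta k.+1 h = a k h *m zeta k h + b k h *m delta k h) ->
  (forall k, (d <= k <= N)%N -> adapted th k (zeta k)) ->
  dot (zeta d) (lam d)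
    + \sum_(d <= k < N.+1) dot (delta k) (fun h => (b k h)^T *m lam k.+1 h)
  = \sum_(d <= k < N.+1) dot (zeta k) (fun h => Q *m Z z0 v k h)
    + dot (zeta N.+1) (fun h => PN1 *m Z z0 v N.+1 h).
Proof.
move=> [lE lN] zE za.
suff dual r : (d + r <= N.+1)%N ->
    dot (zeta d) (lam d)
      + \sum_(d <= k < d + r) dot (delta k) (fun h => (b k h)^T *m lam k.+1 h)
    = \sum_(d <= k < d + r) dot (zeta k) (fun h => Q *m Z z0 v k h)
      + dot (zeta (d + r)%N) (lam (d + r)%N).
  have := dual (N.+1 - d)%N.
  rewrite subnKC; last by lia.
  move=> /(_ (leqnn _)) ->.
  by congr (_ + _); apply: eq_dot.
elim: r => [|r IH] rN; first by rewrite addn0 !big_geq // addr0 add0r.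
rewrite addnS !big_nat_recr ?leq_addr //= addrA IH -?addrA; last by lia.
congr (_ + _).
have -> : dot (zeta (d + r)%N) (lam (d + r)%N) =
    dot (zeta (d + r)%N) (fun h => Q *m Z z0 v (d + r)%N h) +
    dot (zeta (d + r)%N) (fun h => (a (d + r)%N h)^T *m lam (d + r).+1 h).
  rewrite -(@dot_condE _ _ p th p_gt0 _ (d + r) _
    (fun h => (a (d + r)%N h)^T *m lam (d + r).+1 h)); last by apply: za; lia.
  rewrite -dotDr; apply: eq_dot => // h; rewrite lE //; lia.
rewrite -addrA; congr (_ + _).
rewrite (eq_dot _ (zE _) (frefl _)) dotDl.
by rewrite !dot_mull.
Qed.

Lemma fcostE z0 v : fcost z0 v =
  \sum_(0 <= k < N.+1) (dot (Z z0 v k) (fun h => Q *m Z z0 v k h)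
                        + dot (v k) (fun h => Rw *m v k h))
  + dot (Z z0 v N.+1) (fun h => PN1 *m Z z0 v N.+1 h).
Proof.
rewrite /fcost meanD mean_sum dot_qform; congr (_ + _).
by apply: eq_bigr => k _; rewrite !dot_qform meanD.
Qed.

Lemma dot_quad r (W : 'M[R]_r) (x y : H -> 'cV[R]_r) : W^T = W ->
  dot (fun h => x h + y h) (fun h => W *m (x h + y h)) =
  dot x (fun h => W *m x h) + 2 * dot y (fun h => W *m x h)
  + dot y (fun h => W *m y h).
Proof.
move=> sW.
have -> : dot (fun h => x h + y h) (fun h => W *m (x h + y h)) =
    dot (fun h => x h + y h) (fun h => W *m x h + W *m y h).
  by apply: eq_dot => // h; rewrite mulmxDr.
rewrite dotDl !dotDr.
have -> : dot x (fun h => W *m y h) = dot y (fun h => W *m x h).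
  by rewrite dotC dot_mull; apply: eq_dot => // h; rewrite sW.
by ring.
Qed.

Lemma gradient_adapted u0 v lam k : causal u0 v -> (d <= k <= N)%N ->
  adapted th (k - d) (gradient v lam k).
Proof.
move=> cv kN h h' hh'.
by rewrite /gradient (cv.2 _ kN _ _ hh') (condE_adapted _ _ hh').
Qed.

Lemma gradient_dot v lam k x : adapted th (k - d) x ->
  dot x (gradient v lam k) = dot x (fun h => Rw *m v k h)
    + dot x (fun h => (b k h)^T *m lam k.+1 h).
Proof. by move=> hx; rewrite dotDr dot_condE. Qed.

(** The cross terms between the trajectory of [v] and that of the increment are
    those that [duality] turns into a pairing with the gradient; they start at
    step [d], because the increment vanishes before. *)
Lemma fcost_variation u0 z0 v v' lam : causal u0 v -> causal u0 v' ->
  costate z0 v lam ->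
  let delta k h := v' k h - v k h in
  fcost z0 v' = fcost z0 v
    + 2 * \sum_(d <= k < N.+1) dot (delta k) (gradient v lam k)
    + fcost 0 delta.
Proof.
move=> cv cv' lE delta; have cd := causalB cv cv' : causal _ delta.
have d0 k : (k < d)%N -> forall h, delta k h = 0.
  by move=> kd h; rewrite (cd.1 (Ordinal kd)).
have z0' k : (k <= d)%N -> forall h, Z 0 delta k h = 0.
  by move=> kd h; apply: traj0 => j jk; apply: d0; lia.
have -> : \sum_(d <= k < N.+1) dot (delta k) (gradient v lam k) =
    \sum_(0 <= k < N.+1) (dot (Z 0 delta k) (fun h => Q *m Z z0 v k h)
                          + dot (delta k) (fun h => Rw *m v k h))
    + dot (Z 0 delta N.+1) (fun h => PN1 *m Z z0 v N.+1 h).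
  rewrite [in RHS](@big_cat_nat _ _ _ d) //=; last by lia.
  rewrite [X in _ = X + _ + _]big_nat_cond [X in _ = X + _ + _]big1 ?add0r;
    last first.
    move=> k /andP[/andP[_ kd] _].
    by rewrite (dot0l _ _ (d0 _ kd)) (dot0l _ _ (z0' _ (ltnW kd))) addr0.
  have := @duality z0 v lam (Z 0 delta) delta lE (fun _ _ => erefl) _.
  rewrite (dot0l _ _ (z0' _ (leqnn _))) add0r => dual.
  rewrite big_split /= addrAC -dual; last first.
    by move=> k kN; apply: traj_adapted cd _; lia.
  rewrite -big_split; apply: eq_big_nat => k kN /=.
  rewrite gradient_dot 1?addrC //.
  by apply: (causal_adapted cd); lia.
have vE k h : v' k h = v k h + delta k h by rewrite addrC subrK.
have zE k h : Z z0 v' k h = Z z0 v k h + Z 0 delta k h.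
  by rewrite -(trajB a b z0) addrC subrK.
rewrite !fcostE.
have quad r (W : 'M[R]_r) (x y x' : H -> 'cV[R]_r) : W^T = W ->
    (forall h, x' h = x h + y h) -> dot x' (fun h => W *m x' h) =
    dot x (fun h => W *m x h) + 2 * dot y (fun h => W *m x h)
    + dot y (fun h => W *m y h).
  by move=> sW e; rewrite -dot_quad //; apply: eq_dot => // h; rewrite e.
rewrite (quad _ _ _ _ _ PN1_psd.1 (zE _)).
have -> : \sum_(0 <= k < N.+1) (dot (Z z0 v' k) (fun h => Q *m Z z0 v' k h)
      + dot (v' k) (fun h => Rw *m v' k h)) =
  \sum_(0 <= k < N.+1) (dot (Z z0 v k) (fun h => Q *m Z z0 v k h)
      + dot (v k) (fun h => Rw *m v k h)) +
  2 * \sum_(0 <= k < N.+1) (dot (Z 0 delta k) (fun h => Q *m Z z0 v k h)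
                          + dot (delta k) (fun h => Rw *m v k h)) +
  \sum_(0 <= k < N.+1) (dot (Z 0 delta k) (fun h => Q *m Z 0 delta k h)
      + dot (delta k) (fun h => Rw *m delta k h)).
  rewrite mulr_sumr -!big_split; apply: eq_bigr => k _ /=.
  rewrite (quad _ _ _ _ _ Q_psd.1 (zE k)) (quad _ _ _ _ _ Rw_psd.1 (vE k)).
  by ring.
by ring.
Qed.

Lemma fcost_ge0 z0 v : 0 <= fcost z0 v.
Proof.
apply: mean_ge0 => // h; rewrite addr_ge0 ?sumr_ge0 // => [k _|].
  by rewrite addr_ge0 //; [exact: Q_psd.2|exact: Rw_psd.2].
exact: PN1_psd.2.
Qed.

Lemma fcost_split z0 v lam u0 : causal u0 v -> costate z0 v lam ->
  fcost z0 v = \sum_(0 <= k < d) (dot (Z z0 v k) (fun h => Q *m Z z0 v k h)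
                        + dot (v k) (fun h => Rw *m v k h))
   + dot (Z z0 v d) (lam d)
   + \sum_(d <= k < N.+1) dot (v k) (gradient v lam k).
Proof.
move=> cv lE; rewrite fcostE (@big_cat_nat _ _ _ d) //=; last by lia.
rewrite -!addrA; congr (_ + _).
have := @duality z0 v lam (Z z0 v) v lE (fun _ _ => erefl) _ => dual.
rewrite big_split /= addrAC -dual; last first.
  by move=> k kN; apply: traj_adapted cv _; lia.
rewrite -addrA -big_split; congr (_ + _); apply: eq_big_nat => k kN /=.
rewrite gradient_dot 1?addrC //.
by apply: (causal_adapted cv); lia.
Qed.

Definition fopt z0 u0 v : Prop :=
  causal u0 v /\ forall v', causal u0 v' -> fcost z0 v <= fcost z0 v'.

Definition stationary v lam : Prop :=
  forall k h, (d <= k <= N)%N -> gradient v lam k h = 0.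

(** Convexity: the second order term is itself a cost. *)
Lemma stationary_opt z0 u0 v lam : causal u0 v -> costate z0 v lam ->
  stationary v lam -> fopt z0 u0 v.
Proof.
move=> cv lE st; split=> // v' cv'; rewrite (fcost_variation cv cv' lE).
rewrite big_nat_cond big1 ?mulr0 ?addr0 ?lerDl ?fcost_ge0 //.
by move=> k /andP[kN _]; rewrite dot0r // => h; apply: st; lia.
Qed.

Lemma fcostZ v e : fcost 0 (fun k h => e *: v k h) = e ^+ 2 * fcost 0 v.
Proof.
have zE k h : Z 0 (fun k h => e *: v k h) k h = e *: Z 0 v k h.
  elim: k => [|k IH] /=; first by rewrite scaler0.
  by rewrite IH scalerDr -!scalemxAr.
have qE r (W : 'M[R]_r) x : qform W (e *: x) = e ^+ 2 * qform W x.
  have eT : (e *: x)^T = e *: x^T by rewrite linearZ.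
  by rewrite /qform eT -scalemxAr -!scalemxAl scalerA mxE expr2.
rewrite /fcost /mean mulr_sumr; apply: eq_bigr => h _.
rewrite [RHS]mulrCA; congr (_ * _).
rewrite mulrDr mulr_sumr zE qE; congr (_ + _).
by apply: eq_bigr => k _; rewrite zE !qE mulrDr.
Qed.

(** The quadratic is negative at [- l / (1 + c)] unless [l = 0]; the denominator
    [1 + c] instead of [c] also covers [c = 0]. *)
Lemma quadratic_min (l c : R) : (forall e, 0 <= 2 * (e * l) + e ^+ 2 * c) ->
  l = 0.
Proof.
move=> h; have c0 : 0 <= c by have := h 1; have := h (-1); nra.
apply/eqP; apply: contraT => l0.
have := h (- (l / (1 + c))); have c1 : 0 < 1 + c by lra.
have l2 : 0 < l ^+ 2 by rewrite exprn_even_gt0.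
have -> : 2 * (- (l / (1 + c)) * l) + (- (l / (1 + c))) ^+ 2 * c =
  - (l ^+ 2 * (2 + c) / (1 + c) ^+ 2).
  by field; rewrite gt_eqF.
rewrite oppr_ge0 leNgt divr_gt0 ?exprn_gt0 // mulr_gt0 //; lra.
Qed.

(** Variation in the direction of the gradient itself, which is causal. *)
Lemma opt_stationary z0 u0 v lam : fopt z0 u0 v -> costate z0 v lam ->
  stationary v lam.
Proof.
move=> [cv opt] lE.
pose x k h := if (d <= k <= N)%N then gradient v lam k h else 0.
have cx : causal (fun=> 0) x.
  split=> [[i id] h|k kN]; first by rewrite /x leqNgt id.
  by rewrite /x kN => h h' hh'; exact: (gradient_adapted _ cv kN hh').
have : \sum_(d <= k < N.+1) dot (x k) (gradient v lam k) = 0.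
  apply: (@quadratic_min _ (fcost 0 x)) => e.
  have := opt _ (causalDZ e cv cx).
  rewrite (fcost_variation cv (causalDZ e cv cx) lE) -addrA lerDl.
  congr (0 <= 2 * _ + _).
    rewrite mulr_sumr; apply: eq_bigr => k _.
    by rewrite -dotZl; apply: eq_dot => // h; rewrite addrC addKr.
  rewrite -fcostZ; congr fcost; apply/funext => k; apply/funext => h.
  by rewrite addrC addKr.
rewrite (eq_big_nat _ _ (F2 := fun k => dot (x k) (x k))); last first.
  by move=> k kN; apply: eq_dot => // h; rewrite /x -ltnS kN.
rewrite big_nat_cond => /eqP; rewrite psumr_eq0; last by move=> k _; exact: dot_ge0.
move=> /allP s0 k h kN.
have := s0 k; rewrite mem_index_iota ltnS kN => /(_ isT)/eqP/dot_eq0.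
by move=> /(_ p_gt0 h); rewrite /x kN.
Qed.

End Variation.

(** * The backward recursion on a finite space *)

Lemma down_ind (d N : nat) (K : nat -> Prop) :
  (forall k, (d <= k <= N)%N -> (forall j, (k < j <= N)%N -> K j) -> K k) ->
  forall k, (d <= k <= N)%N -> K k.
Proof.
move=> step k; have [r] := ubnP (N - k); elim: r k => // r IH k kr kN.
by apply: step => // j jk; apply: IH; lia.
Qed.

(** Feedback controls are defined through the trajectory that they generate; this
    is the recursion that solves for them. *)
Lemma history_fix (X : Type) (x0 : X) (phi : nat -> (nat -> X) -> X) :
  (forall k f g, (forall j, (j < k)%N -> f j = g j) -> phi k f = phi k g) ->
  exists f, forall k, f k = phi k f.
Proof.
move=> ext.
pose fix tab k : nat -> X := if k is k'.+1 then
  fun j => if j == k' then phi k' (tab k') else tab k' j else fun=> x0.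
have tabE r j : (j < r)%N -> tab r j = tab j.+1 j.
  elim: r => [//|r IH] jr /=; case: (eqVneq j r) => [->|jr']; first by rewrite eqxx.
  by rewrite IH /= ?eqxx //; lia.
exists (fun k => tab k.+1 k) => k /=; rewrite eqxx; apply: ext => j jk.
exact: tabE.
Qed.

Lemma posdef_unitmx (R : realType) (m : nat) (W : 'M[R]_m) :
  posdefmx W -> W \in unitmx.
Proof.
move=> [_ pos]; rewrite unitmxE unitfE; apply/det0P => -[x x0 xW].
have := pos x^T; rewrite /qform trmxK xW mul0mx mxE ltxx.
suff -> : x^T != 0 by move=> /(_ isT).
by apply: contra x0 => /eqP xT; rewrite -(trmxK x) xT trmx0.
Qed.

Section Riccati.
Context {R : realType} {H : finType} {q m : nat}.
Variables (p : H -> R) (th : nat -> H -> bool).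
Variables (a : nat -> H -> 'M[R]_q) (b : nat -> H -> 'M[R]_(q, m)).
Variables (Q : 'M[R]_q) (Rw : 'M[R]_m) (PN1 : 'M[R]_q) (d N : nat).

Local Notation E := (condE p th).
Local Notation Z := (traj a b).
Local Notation aprod := (aprod a).

(** The recursion as a system of equations between given sequences, with averages
    over the finite space instead of versions of conditional expectations. *)
Record riccati (Pb : nat -> H -> 'M[R]_q) (G : nat -> H -> 'M[R]_m)
    (M0 : nat -> H -> 'M[R]_(m, q)) (M : nat -> nat -> H -> 'M[R]_m)
    (S : nat -> H -> 'M[R]_(q, m)) (F : nat -> nat -> H -> 'M[R]_(q, m)) :
    Prop := Riccati {
  ric_Pend : forall h, Pb N.+1 h = PN1;
  ric_Gend : forall k h, (N < k)%N -> G k h = 0;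
  ric_M0end : forall k h, (N < k)%N -> M0 k h = 0;
  ric_Mend : forall k i h, (N < k)%N -> M k i h = 0;
  ric_S : forall k h, (d <= k <= N)%N ->
    S k h = E k (fun h => (a k h)^T *m Pb k.+1 h *m b k h) h;
  ric_G : forall k h, (d <= k <= N)%N ->
    G k h = Rw + E (k - d) (fun h => (b k h)^T *m Pb k.+1 h *m b k h
      - \sum_(0 <= i < d) (M (k + i.+1)%N i.+1 h)^T
          *m invmx (G (k + i.+1)%N h) *m M (k + i.+1)%N i.+1 h) h;
  ric_M0 : forall k h, (d <= k <= N)%N ->
    M0 k h = E (k - d) (fun h => (S k h)^T *m aprod (k - d) k h
      - \sum_(0 <= i < d) (M (k + i.+1)%N i.+1 h)^T
          *m invmx (G (k + i.+1)%N h) *m M0 (k + i.+1)%N h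
          *m aprod (k - d) (k - d + i).+1 h) h;
  ric_Mle : forall k i h, (d <= k <= N)%N -> (1 <= i <= d)%N ->
    M k i h = E (k - d)
      (fun h => (S k h)^T *m aprod (k - i).+1 k h *m b (k - i)%N h
      - \sum_(0 <= s < d) (M (k + s.+1)%N s.+1 h)^T
          *m invmx (G (k + s.+1)%N h) *m M (k + s.+1)%N (i + s.+1)%N h) h;
  ric_Mgt : forall k i h, (d <= k <= N)%N -> (d < i <= k)%N ->
    M k i h = M0 k h *m E (k - d)
      (fun h => aprod (k - i).+1 (k - d) h *m b (k - i)%N h) h;
  ric_P : forall k h, (d <= k <= N)%N ->
    Pb k h = Q + E k (fun h => (a k h)^T *m Pb k.+1 h *m a k h
      - (M0 (k + d)%N h)^T *m invmx (G (k + d)%N h) *m M0 (k + d)%N h) h;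
  ric_F1 : forall k h, (d <= k <= N)%N ->
    F k 1 h = S k h - \sum_(0 <= i < d)
      F k i.+2 h *m invmx (G (k + i.+1)%N h) *m M (k + i.+1)%N i.+1 h;
  ric_Fge : forall k i h, (d <= k <= N)%N -> (2 <= i)%N ->
    F k i h = E k (fun h => (a k h)^T *m F k.+1 i.-1 h) h }.

Hypothesis p_gt0 : forall h, 0 < p h.
Hypothesis a_adapted : forall k, adapted th k.+1 (a k).
Hypothesis b_adapted : forall k, adapted th k.+1 (b k).
Hypothesis dN : (d <= N)%N.
Hypothesis Q_psd : possemidefmx Q.
Hypothesis Rw_psd : possemidefmx Rw.
Hypothesis PN1_psd : possemidefmx PN1.

Let Q_sym : Q^T = Q := Q_psd.1.
Let Rw_sym : Rw^T = Rw := Rw_psd.1.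
Let PN1_sym : PN1^T = PN1 := PN1_psd.1.

Variables (Pb : nat -> H -> 'M[R]_q) (G : nat -> H -> 'M[R]_m).
Variables (M0 : nat -> H -> 'M[R]_(m, q)) (M : nat -> nat -> H -> 'M[R]_m).
Variables (S : nat -> H -> 'M[R]_(q, m)) (F : nat -> nat -> H -> 'M[R]_(q, m)).
Hypothesis ric : riccati Pb G M0 M S F.

Lemma aprod_adapted i j k : (j <= k)%N -> adapted th k (aprod i j).
Proof.
move=> jk; apply: adapted_bigop => t; rewrite mem_rev mem_index_iota => tj.
by apply: adapted_le (@a_adapted t) _; lia.
Qed.

Lemma S_adapted k : (d <= k <= N)%N -> adapted th k (S k).
Proof.
by move=> kN h h' hh; rewrite !(ric_S ric) // (condE_adapted _ _ hh).
Qed.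

Lemma G_adapted k : (d <= k)%N -> adapted th (k - d) (G k).
Proof.
move=> dk h h' hh; have [kN|Nk] := leqP k N; last by rewrite !(ric_Gend ric).
by rewrite !(ric_G ric) ?dk // (condE_adapted _ _ hh).
Qed.

Lemma M0_adapted k : (d <= k)%N -> adapted th (k - d) (M0 k).
Proof.
move=> dk h h' hh; have [kN|Nk] := leqP k N; last by rewrite !(ric_M0end ric).
by rewrite !(ric_M0 ric) ?dk // (condE_adapted _ _ hh).
Qed.

Lemma M_adapted k i : (d <= k)%N -> (1 <= i <= k)%N ->
  adapted th (k - d) (M k i).
Proof.
move=> dk /andP[i1 ik] h h' hh.
have [kN|Nk] := leqP k N; last by rewrite !(ric_Mend ric).
have [id|di] := leqP i d.
  by rewrite !(ric_Mle ric) ?dk ?i1 // (condE_adapted _ _ hh).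
rewrite !(ric_Mgt ric) ?dk ?di // (condE_adapted _ _ hh).
by rewrite (M0_adapted dk hh).
Qed.

Lemma F_adapted k i : (d <= k <= N)%N -> (1 <= i)%N -> adapted th k (F k i).
Proof.
move=> kN; have Fge j : (2 <= j)%N -> adapted th k (F k j).
  by move=> j2 h h' hh; rewrite !(ric_Fge ric) // (condE_adapted _ _ hh).
case: i => [//|[_|i _]]; last exact: Fge.
move=> h h' hh; rewrite !(ric_F1 ric) // (S_adapted kN hh); congr (_ - _).
apply: eq_big_nat => i id; rewrite (Fge i.+2 _ _ _ hh) //.
rewrite (adapted_le (G_adapted (k := k + i.+1) _) _ hh); [|by lia..].
by rewrite (adapted_le (M_adapted (k := k + i.+1) (i := i.+1) _ _) _ hh) //; lia.
Qed.

Lemma riccati_sym k : (d <= k <= N)%N ->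
  (forall h, (G k h)^T = G k h) /\ (forall h, (Pb k h)^T = Pb k h).
Proof.
move: k; apply: down_ind => k kN IH.
have Gs j h : (k < j)%N -> (G j h)^T = G j h.
  move=> kj; have [jN|Nj] := leqP j N; last by rewrite (ric_Gend ric) ?trmx0.
  by have [] := IH j ltac:(lia).
have Ps h : (Pb k.+1 h)^T = Pb k.+1 h.
  have [jN|Nj] := leqP k.+1 N; first by have [] := IH k.+1 ltac:(lia).
  by (have -> : k = N by lia); rewrite (ric_Pend ric) PN1_sym.
have Gks h : (G k h)^T = G k h.
  rewrite (ric_G ric) // linearD /= Rw_sym -condE_tr; congr (_ + E _ _ _).
  apply/funext => h'; rewrite linearB /= !trmx_mul trmxK Ps mulmxA; congr (_ - _).
  rewrite linear_sum /=; apply: eq_big_nat => i id.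
  by rewrite !trmx_mul trmxK trmx_inv Gs ?mulmxA //; lia.
split=> // h; rewrite (ric_P ric) // linearD /= Q_sym -condE_tr.
congr (_ + E _ _ _); apply/funext => h'.
rewrite linearB /= !trmx_mul !trmxK Ps mulmxA trmx_inv mulmxA; congr (_ - _).
have [d0|d0] := leqP d 0; first by (have -> : (k + d = k)%N by lia); rewrite Gks.
by rewrite Gs //; lia.
Qed.

Lemma G_sym k h : (d <= k)%N -> (G k h)^T = G k h.
Proof.
move=> dk; have [kN|Nk] := leqP k N; last by rewrite (ric_Gend ric) ?trmx0.
by have [] := riccati_sym (k := k) ltac:(lia).
Qed.

Lemma P_sym k h : (d <= k <= N.+1)%N -> (Pb k h)^T = Pb k h.
Proof.
move=> kN; have [kN'|Nk] := leqP k N;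
  first by have [] := riccati_sym (k := k) ltac:(lia).
by (have -> : k = N.+1 by lia); rewrite (ric_Pend ric) PN1_sym.
Qed.

(** F^(i+1) is F^1 of a later step, carried back by the adjoint dynamics. *)
Lemma F_iter k i h : (d <= k)%N -> (k + i <= N)%N ->
  F k i.+1 h = E k (fun h => (aprod k (k + i) h)^T *m F (k + i)%N 1 h) h.
Proof.
elim: i k h => [|i IH] k h dk kN.
  rewrite addn0 -{1}(@condE_id _ _ p th p_gt0 _ k (F k 1)); last first.
    by apply: F_adapted; lia.
  by congr (E _ _ _); apply/funext => h'; rewrite aprod_geq // trmx1 mul1mx.
rewrite (ric_Fge ric) //=; last by lia.
rewrite -[RHS](condE_tower th p_gt0 _ _ (leqnSn k)).
congr (E _ _ _); apply/funext => h'.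
rewrite IH; [|by lia..]; rewrite -(condE_mull p (C := fun h => (a k h)^T));
  last exact: adapted1.
congr (E _ _ _); apply/funext => h2.
by rewrite addSnnS mulmxA -trmx_mul -aprod_recl //; lia.
Qed.

(** The induction step shared by [M0_adjoint] and [M_adjoint], where [C] is the
    identity and the input matrix of time [k - i] respectively.  The recursion for M and the
    definition of F^1 have the same sum over [i], except that the second contains
    F^(i+2); given the past at time [k - d + i + 1], [F_iter] turns it into F^1 of
    step [k + i + 1], to which the hypothesis on [Y] applies. *)
Lemma adjoint_step r k j (C : H -> 'M[R]_(q, r)) (Y : nat -> H -> 'M[R]_(m, r)) h :
  (d <= k <= N)%N -> (j <= k)%N -> adapted th k C ->
  (forall i h, (i < d)%N -> (k + i.+1 <= N)%N ->
     (Y i h)^T = E (k - d + i.+1) (fun h =>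
       (aprod j (k + i.+1) h *m C h)^T *m F (k + i.+1)%N 1 h) h) ->
  (E (k - d) (fun h => (S k h)^T *m aprod j k h *m C h
     - \sum_(0 <= i < d) (M (k + i.+1)%N i.+1 h)^T
         *m invmx (G (k + i.+1)%N h) *m Y i h) h)^T
  = E (k - d) (fun h => (aprod j k h *m C h)^T *m F k 1 h) h.
Proof.
move=> kN jk hC hY; rewrite -condE_tr.
have -> : (fun h => (aprod j k h *m C h)^T *m F k 1 h) = (fun h =>
    (aprod j k h *m C h)^T *m S k h - \sum_(0 <= i < d)
      (aprod j k h *m C h)^T *m F k i.+2 h
        *m (invmx (G (k + i.+1)%N h) *m M (k + i.+1)%N i.+1 h)).
  apply/funext => h'; rewrite (ric_F1 ric) // mulmxBr mulmx_sumr; congr (_ - _).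
  by apply: eq_bigr => i _; rewrite !mulmxA.
have -> : (fun h => ((S k h)^T *m aprod j k h *m C h
     - \sum_(0 <= i < d) (M (k + i.+1)%N i.+1 h)^T
         *m invmx (G (k + i.+1)%N h) *m Y i h)^T) = (fun h =>
     (aprod j k h *m C h)^T *m S k h - \sum_(0 <= i < d)
      (Y i h)^T *m (invmx (G (k + i.+1)%N h) *m M (k + i.+1)%N i.+1 h)).
  apply/funext => h'; rewrite linearB /= -mulmxA trmx_mul trmxK; congr (_ - _).
  rewrite linear_sum; apply: eq_bigr => i _ /=.
  by rewrite !trmx_mul trmxK trmx_inv G_sym //; lia.
rewrite !condEB; congr (_ - _); rewrite !condE_sum; apply: eq_big_nat => i id.
have [kiN|Nki] := leqP (k + i.+1) N; last first.
  by congr (E _ _ _); apply/funext => h'; rewrite (ric_Mend ric) // !mulmx0.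
have ke : (k - d <= k - d + i.+1)%N by lia.
rewrite -[RHS](condE_tower th p_gt0 _ _ ke); congr (E _ _ _); apply/funext => h'.
have eE : (k + i.+1 - d = k - d + i.+1)%N by lia.
rewrite condE_mulr; last first.
  rewrite -eE; apply: adapted2; last by apply: M_adapted; lia.
  by apply: adapted1; apply: G_adapted; lia.
congr (_ *m _); rewrite hY //.
have ek : (k - d + i.+1 <= k)%N by lia.
rewrite -[RHS](condE_tower th p_gt0 _ _ ek) -[LHS](condE_tower th p_gt0 _ _ ek).
congr (E _ _ _); apply/funext => h2.
rewrite [RHS](condE_id p_gt0); last first.
  apply: adapted2; last by apply: F_adapted; lia.
  by apply: adapted1; apply: adapted2 => //; exact: aprod_adapted.
rewrite F_iter; [|by lia..].
rewrite -(condE_mull p (C := fun h => (aprod j k h *m C h)^T)); last first.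
  by apply: adapted1; apply: adapted2 => //; exact: aprod_adapted.
congr (E _ _ _); apply/funext => h3.
by rewrite mulmxA -trmx_mul mulmxA -aprod_cat //; lia.
Qed.

(** Together with [M_adjoint], the reason for the shape of the recursion: M^0 and
    M^i measure how the stationarity condition of step [k], in which the future is
    summarised by F^1, reacts to the state of time [k - d] and to the control of
    step [k - i]. *)
Lemma M0_adjoint k h : (d <= k <= N)%N ->
  (M0 k h)^T = E (k - d) (fun h => (aprod (k - d) k h)^T *m F k 1 h) h.
Proof.
move=> kN; move: k kN h; apply: down_ind => k kN IH h.
have := @adjoint_step q k (k - d) (fun=> 1%:M)
  (fun i h => M0 (k + i.+1)%N h *m aprod (k - d) (k - d + i).+1 h) h kN.
rewrite (ric_M0 ric) // => step.
rewrite (_ : (fun h => (aprod (k - d) k h)^T *m F k 1 h) =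
  (fun h => (aprod (k - d) k h *m 1%:M)^T *m F k 1 h)); last first.
  by apply/funext => h'; rewrite mulmx1.
rewrite -step ?leq_subr //.
  congr (_^T); congr (E _ _ _); apply/funext => h'; rewrite mulmx1.
  by congr (_ - _); apply: eq_bigr => i _; rewrite !mulmxA.
move=> i h' id kiN; rewrite trmx_mul IH; last by lia.
have eE : (k + i.+1 - d = k - d + i.+1)%N by lia.
rewrite eE -(condE_mull p (C := fun h => (aprod (k - d) (k - d + i).+1 h)^T));
  last by apply: adapted1; apply: aprod_adapted; lia.
congr (E _ _ _); apply/funext => h2.
by rewrite mulmx1 mulmxA -trmx_mul -addnS -aprod_cat //; lia.
Qed.

(** A control applied before time [k - d] acts on step [k] only through the state
    of time [k - d]. *)
Lemma M_gt_state k j h : (d <= k <= N)%N -> (j < k - d)%N ->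
  M k (k - j) h = M0 k h *m aprod j.+1 (k - d) h *m b j h.
Proof.
move=> kN jk; rewrite (ric_Mgt ric) //; last by lia.
have -> : (k - (k - j) = j)%N by lia.
rewrite (condE_id p_gt0) ?mulmxA //; apply: adapted2; first exact: aprod_adapted.
exact: adapted_le (@b_adapted j) _.
Qed.

Lemma M_adjoint k i h : (d <= k <= N)%N -> (1 <= i <= k)%N ->
  (M k i h)^T = E (k - d)
    (fun h => (aprod (k - i).+1 k h *m b (k - i)%N h)^T *m F k 1 h) h.
Proof.
move=> kN; move: k kN i h; apply: down_ind => k kN IH i h ik.
have [id|di] := leqP i d.
  rewrite (ric_Mle ric) //; last by lia.
  apply: adjoint_step => //; first by lia.
    by apply: adapted_le (@b_adapted _) _; lia.
  move=> s h' sd ksN; rewrite IH; [|by lia..].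
  have -> : (k + s.+1 - d = k - d + s.+1)%N by lia.
  by have -> : (k + s.+1 - (i + s.+1) = k - i)%N by lia.
have iE : (i = k - (k - i))%N by lia.
rewrite {1}iE M_gt_state //; last by lia.
rewrite -mulmxA trmx_mul M0_adjoint //.
rewrite -(condE_mull p
  (C := fun h => (aprod (k - i).+1 (k - d) h *m b (k - i)%N h)^T)); last first.
  apply: adapted1; apply: adapted2; first exact: aprod_adapted.
  by apply: adapted_le (@b_adapted _) _; lia.
congr (E _ _ _); apply/funext => h'.
by rewrite mulmxA -trmx_mul mulmxA -aprod_cat //; lia.
Qed.

(** * Closed form of the costate *)

Section ClosedForm.
Variables (u0 : 'I_d -> 'cV[R]_m) (z0 : 'cV[R]_q) (v : nat -> H -> 'cV[R]_m).

(** What the stationarity condition of step [k + s] contains apart from the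
    controls of the steps [k, ..., k + s].  For [s = 0] it is the affine part
    of that condition, from which the feedback law of step [k] is solved. *)
Definition drift (k s : nat) (h : H) : 'cV[R]_m :=
  M0 (k + s)%N h *m Z z0 v (k - d + s)%N h
  + \sum_(s.+1 <= i < d.+1) M (k + s)%N i h *m v (k + s - i)%N h.

(** The closed form of the costate, with the state and control terms of each [s]
    collected in [drift]. *)
Definition closed_costate (k : nat) (h : H) : 'cV[R]_q :=
  Pb k h *m Z z0 v k h
  - \sum_(0 <= s < d) F k s.+1 h *m invmx (G (k + s)%N h) *m drift k s h.

Lemma drift_end k s h : (N < k + s)%N -> drift k s h = 0.
Proof.
move=> Nk; rewrite /drift (ric_M0end ric) // mul0mx add0r big1 // => i _.
by rewrite (ric_Mend ric) // mul0mx.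
Qed.

Lemma traj_delay k h : (d <= k)%N ->
  Z z0 v k h = aprod (k - d) k h *m Z z0 v (k - d)%N h
    + \sum_(1 <= i < d.+1) aprod (k - i).+1 k h *m b (k - i)%N h *m v (k - i)%N h.
Proof.
move=> dk; rewrite -(sum_nat_down
  (fun j => aprod j.+1 k h *m b j h *m v j h) dk).
by have := traj_aprod a b z0 v (k - d) d h; rewrite subnK.
Qed.

(** Unrolling the state of time [k - d + s + 1] down to time [k - d] produces
    controls that are delayed by more than [d] steps with respect to step
    [k + s + 1]; by [M_gt_state] their coefficients are the matrices M^i with
    [d < i], which continue the sum already present in [drift]. *)
Lemma drift_later k s h : (d <= k)%N -> (s < d)%N -> (k + s.+1 <= N)%N ->
  drift k.+1 s h =
    M0 (k + s.+1)%N h *m aprod (k - d) (k - d + s).+1 h *m Z z0 v (k - d)%N h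
    + \sum_(0 <= i < d.+1) M (k + s.+1)%N (i + s.+1)%N h *m v (k - i)%N h.
Proof.
move=> dk sd ksN; rewrite /drift.
have -> : (k.+1 + s = k + s.+1)%N by lia.
have -> : (k.+1 - d + s = k - d + s.+1)%N by lia.
rewrite -[(k - d + s).+1]addnS (traj_aprod a b z0 v (k - d)) mulmxDr mulmxA.
rewrite -addrA; congr (_ + _).
have -> : \sum_(0 <= i < d.+1) M (k + s.+1)%N (i + s.+1)%N h *m v (k - i)%N h =
    \sum_(s.+1 <= i < d.+1 + s.+1) M (k + s.+1)%N i h *m v (k + s.+1 - i)%N h.
  have := big_addn 0 (d.+1 + s.+1) s.+1 predT
    (fun i => M (k + s.+1)%N i h *m v (k + s.+1 - i)%N h).
  rewrite add0n addnK => ->; apply: eq_big_nat => i _.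
  by congr (_ *m v _ _); lia.
rewrite addrC [RHS](@big_cat_nat _ _ _ d.+1) //=; [|by lia..]; congr (_ + _).
have {1}-> : (k - d = k - d + s.+1 - s.+1)%N by lia.
rewrite sum_nat_down; last by lia.
have := big_addn 1 (d.+1 + s.+1) d predT
  (fun i => M (k + s.+1)%N i h *m v (k + s.+1 - i)%N h).
have -> : (d.+1 + s.+1 - d = s.+2)%N by lia.
rewrite add1n => ->; rewrite mulmx_sumr; apply: eq_big_nat => i /andP[i1 ir].
rewrite mulmxA mulmxA.
have := @M_gt_state (k + s.+1) (k - d + s.+1 - i) h.
have -> : (k + s.+1 - d = k - d + s.+1)%N by lia.
move=> <-; [|by lia..].
by congr (M _ _ _ *m v _ _); lia.
Qed.

Variable lam : nat -> H -> 'cV[R]_q.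
Hypothesis cv : causal th N u0 v.
Hypothesis lE : costate p th a b Q PN1 d N z0 v lam.

Let v_adapted j k : (j <= N)%N -> (j - d <= k)%N -> adapted th k (v j).
Proof. exact: (causal_adapted cv). Qed.

Let Z_adapted j k : (j <= N.+1)%N -> (j <= k)%N -> adapted th k (Z z0 v j).
Proof.
by move=> jN; apply: adapted_le (traj_adapted a_adapted b_adapted dN z0 cv jN).
Qed.

Lemma drift_adapted k s e : (d <= k <= N.+1)%N -> (s <= d)%N ->
  (k - d + s <= e)%N -> adapted th e (drift k s).
Proof.
move=> kN sd kse; have [ksN|Nks] := leqP (k + s) N; last first.
  by move=> h h' _; rewrite !drift_end.
have ksE : (k + s - d <= e)%N by lia.
apply: adapted2.
  apply: adapted2; last by apply: Z_adapted; lia.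
  by apply: adapted_le (M0_adapted _) ksE; lia.
apply: adapted_bigop => i; rewrite mem_index_iota => i_s; apply: adapted2.
  by apply: adapted_le (M_adapted _ _) ksE; lia.
by apply: v_adapted; lia.
Qed.

Lemma invG_drift_adapted k s e : (d <= k <= N)%N -> (s < d)%N ->
  (k - d + s.+1 <= e)%N ->
  adapted th e (fun h => invmx (G (k + s.+1)%N h) *m drift k.+1 s h).
Proof.
move=> kN sd kse; apply: adapted2; last by apply: drift_adapted; lia.
by apply: adapted1; apply: adapted_le (G_adapted _) _; lia.
Qed.

(** Each F^(s+1) in the closed form of the costate of step [k + 1] becomes, after
    multiplication by the transposed input matrix and conditioning, the matrix
    M^(s+1) of step [k + s + 1] ([M_adjoint]).  With the state of time [k] and the
    drifts expressed by the state of time [k - d] and the controls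
    ([traj_delay], [drift_later]), the coefficients are the right-hand sides of the
    recursion for M^0, M^i and Gamma. *)
Lemma gradient_closed k h : (d <= k <= N)%N ->
  lam k.+1 =1 closed_costate k.+1 ->
  gradient p th b Rw d v lam k h = G k h *m v k h + drift k 0 h.
Proof.
move=> kN lk; rewrite /gradient.
(* The integrand after F has been traded for M; TZ, TV and T0 are the integrands
   of the recursion for M^0, M^i and Gamma. *)
pose Y h := (b k h)^T *m Pb k.+1 h *m b k h *m v k h
  + (S k h)^T *m Z z0 v k h
  - \sum_(0 <= s < d) (M (k + s.+1)%N s.+1 h)^T
      *m (invmx (G (k + s.+1)%N h) *m drift k.+1 s h).
have -> : E (k - d) (fun h => (b k h)^T *m lam k.+1 h) h = E (k - d) Y h.
  have -> : (fun h => (b k h)^T *m lam k.+1 h) = fun h =>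
      (b k h)^T *m Pb k.+1 h *m b k h *m v k h
      + (b k h)^T *m Pb k.+1 h *m a k h *m Z z0 v k h
      - \sum_(0 <= s < d) (b k h)^T *m F k.+1 s.+1 h
          *m (invmx (G (k + s.+1)%N h) *m drift k.+1 s h).
    apply/funext => h'; rewrite lk mulmxBr mulmx_sumr /= !mulmxDr !mulmxA.
    rewrite [X in X - _ = _]addrC; congr (_ - _); apply: eq_bigr => s _.
    by rewrite addSnnS !mulmxA.
  rewrite !condEB !condED; congr (_ + _ - _).
    rewrite -[LHS](condE_tower th p_gt0 _ _ (leq_subr d k)).
    congr (E _ _ _); apply/funext => h'.
    rewrite condE_mulr; last by apply: Z_adapted; lia.
    congr (_ *m _); rewrite (ric_S ric) // -condE_tr.
    congr (E _ _ _); apply/funext => h2.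
    by rewrite !trmx_mul trmxK P_sym ?mulmxA //; lia.
  rewrite !condE_sum; apply: eq_big_nat => s sd.
  have [ksN|Nks] := leqP (k + s.+1) N; last first.
    congr (E _ _ _); apply/funext => h'.
    by rewrite drift_end ?mulmx0 //; lia.
  have ke : (k - d <= k - d + s.+1)%N by lia.
  rewrite -[LHS](condE_tower th p_gt0 _ _ ke).
  congr (E _ _ _); apply/funext => h'.
  rewrite condE_mulr; last by apply: invG_drift_adapted; lia.
  congr (_ *m _); rewrite M_adjoint; [|by lia..].
  have -> : (k + s.+1 - d = k - d + s.+1)%N by lia.
  have -> : (k + s.+1 - s.+1 = k)%N by lia.
  have ek : (k - d + s.+1 <= k.+1)%N by lia.
  rewrite -[RHS](condE_tower th p_gt0 _ _ ek).
  congr (E _ _ _); apply/funext => h2.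
  rewrite F_iter; [|by lia..].
  rewrite -(condE_mull p (C := fun h => (b k h)^T)); last exact: adapted1.
  congr (E _ _ _); apply/funext => h3.
  by rewrite mulmxA -trmx_mul addSnnS.
pose TZ h := (S k h)^T *m aprod (k - d) k h
  - \sum_(0 <= i < d) (M (k + i.+1)%N i.+1 h)^T
      *m invmx (G (k + i.+1)%N h) *m M0 (k + i.+1)%N h
      *m aprod (k - d) (k - d + i).+1 h.
pose TV i h := (S k h)^T *m aprod (k - i).+1 k h *m b (k - i)%N h
  - \sum_(0 <= s < d) (M (k + s.+1)%N s.+1 h)^T
      *m invmx (G (k + s.+1)%N h) *m M (k + s.+1)%N (i + s.+1)%N h.
pose T0 h := (b k h)^T *m Pb k.+1 h *m b k h
  - \sum_(0 <= i < d) (M (k + i.+1)%N i.+1 h)^T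
      *m invmx (G (k + i.+1)%N h) *m M (k + i.+1)%N i.+1 h.
have -> : Y = fun h => TZ h *m Z z0 v (k - d)%N h
    + \sum_(1 <= i < d.+1) TV i h *m v (k - i)%N h + T0 h *m v k h.
  apply/funext => h'; rewrite /Y traj_delay; last by lia.
  have -> : \sum_(0 <= s < d) (M (k + s.+1)%N s.+1 h')^T
      *m (invmx (G (k + s.+1)%N h') *m drift k.+1 s h') =
    (\sum_(0 <= i < d) (M (k + i.+1)%N i.+1 h')^T
      *m invmx (G (k + i.+1)%N h') *m M0 (k + i.+1)%N h'
      *m aprod (k - d) (k - d + i).+1 h') *m Z z0 v (k - d)%N h' +
    \sum_(1 <= i < d.+1) (\sum_(0 <= s < d) (M (k + s.+1)%N s.+1 h')^T
      *m invmx (G (k + s.+1)%N h') *m M (k + s.+1)%N (i + s.+1)%N h')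
      *m v (k - i)%N h' +
    (\sum_(0 <= i < d) (M (k + i.+1)%N i.+1 h')^T
      *m invmx (G (k + i.+1)%N h') *m M (k + i.+1)%N i.+1 h') *m v k h'.
    rewrite !mulmx_suml.
    under [X in _ = _ + X + _]eq_bigr do rewrite mulmx_suml.
    rewrite [X in _ = _ + X + _]exchange_big -!big_split /=.
    apply: eq_big_nat => s sd; have [ksN|Nks] := leqP (k + s.+1) N; last first.
      rewrite drift_end; last by lia.
      rewrite !(ric_Mend ric) // trmx0 !mul0mx big1 ?addr0 // => i _.
      by rewrite !mul0mx.
    rewrite drift_later; [|by lia..].
    rewrite [\sum_(0 <= i < d.+1) _]big_ltn // subn0 add0n !mulmxDr !mulmxA -addrA;
      congr (_ + _).
    rewrite addrC; congr (_ + _); rewrite mulmx_sumr.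
    by apply: eq_bigr => i _; rewrite !mulmxA.
  rewrite /TZ /T0 !mulmxBl mulmxDr mulmxA mulmx_sumr.
  under [X in _ = _ + X + _]eq_bigr do rewrite /TV mulmxBl.
  rewrite sumrB.
  under [X in _ + (_ + X) - _]eq_bigr do rewrite !mulmxA.
  by rewrite [X in X - _ = _]addrC !opprD addrACA [X in X + _ = _]addrACA.
rewrite !condED condE_sum condE_mulr; last by apply: Z_adapted; lia.
rewrite condE_mulr; last by apply: v_adapted; lia.
rewrite (eq_big_nat _ _ (F2 := fun i => M k i h *m v (k - i)%N h)); last first.
  move=> i id; rewrite condE_mulr; last by apply: v_adapted; lia.
  by rewrite (ric_Mle ric) //; lia.
rewrite (ric_G ric) // /drift !addn0 mulmxDl (ric_M0 ric) //.
by rewrite [RHS]addrC addrCA -!addrA addrC -!addrA; congr (_ + _).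
Qed.

(** The costate equation raises each F^(s+1) of step [k + 1] to F^(s+2) of step
    [k], and the control of step [k] turns the rest into the missing term with F^1.
    The sum then runs one step too far, up to [s = d]; there F^(d+1) is the
    transpose of M^0 ([F_iter], [M0_adjoint]), and this term is the quadratic
    correction in the recursion for P. *)
Lemma costate_closed k : (d <= k <= N)%N ->
  lam k.+1 =1 closed_costate k.+1 ->
  (forall h, v k h = - (invmx (G k h) *m drift k 0 h)) ->
  lam k =1 closed_costate k.
Proof.
move=> kN lk vk h; rewrite (lE.1 _ _ kN).
have drift_next s h' : (s < d)%N -> drift k.+1 s h' =
    M (k + s.+1)%N s.+1 h' *m v k h' + drift k s.+1 h'.
  move=> sd; rewrite /drift.
  have -> : (k.+1 + s = k + s.+1)%N by lia.
  have -> : (k.+1 - d + s = k - d + s.+1)%N by lia.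
  rewrite big_ltn; last by lia.
  by rewrite addrCA; have -> : (k + s.+1 - s.+1 = k)%N by lia.
have -> : E k (fun h => (a k h)^T *m lam k.+1 h) h =
    E k (fun h => (a k h)^T *m Pb k.+1 h *m a k h) h *m Z z0 v k h
    + S k h *m v k h
    - \sum_(0 <= s < d) F k s.+2 h
        *m (invmx (G (k + s.+1)%N h) *m drift k.+1 s h).
  have -> : (fun h => (a k h)^T *m lam k.+1 h) = fun h =>
      (a k h)^T *m Pb k.+1 h *m a k h *m Z z0 v k h
      + (a k h)^T *m Pb k.+1 h *m b k h *m v k h
      - \sum_(0 <= s < d) (a k h)^T *m F k.+1 s.+1 h
          *m (invmx (G (k + s.+1)%N h) *m drift k.+1 s h).
    apply/funext => h'; rewrite lk mulmxBr mulmx_sumr /= !mulmxDr !mulmxA.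
    congr (_ - _); apply: eq_bigr => s _.
    by rewrite addSnnS !mulmxA.
  rewrite condEB condED condE_sum (@condE_mulr _ _ p th k _ _ _ _ (Z z0 v k));
    last first.
    by apply: Z_adapted; lia.
  rewrite (@condE_mulr _ _ p th k _ _ _ _ (v k)); last by apply: v_adapted; lia.
  rewrite -(ric_S ric) //; congr (_ - _); apply: eq_big_nat => s sd.
  rewrite condE_mulr; last by apply: invG_drift_adapted; lia.
  by rewrite (ric_Fge ric).
have PE : Q + E k (fun h => (a k h)^T *m Pb k.+1 h *m a k h) h =
    Pb k h + (M0 (k + d)%N h)^T *m invmx (G (k + d)%N h) *m M0 (k + d)%N h.
  rewrite (ric_P ric) // condEB addrA [X in _ - X](condE_id p_gt0) ?subrK //.
  have kd : (k + d - d <= k)%N by lia.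
  have dkd : (d <= k + d)%N by lia.
  apply: adapted2; last exact: adapted_le (M0_adapted dkd) kd.
  apply: adapted2; apply: adapted1; first exact: adapted_le (M0_adapted dkd) kd.
  exact: adapted_le (G_adapted dkd) kd.
(* The terms of the closed form, which the costate equation shifts by one. *)
pose f s := F k s.+1 h *m invmx (G (k + s)%N h) *m drift k s h.
have f0 : S k h *m v k h - \sum_(0 <= s < d) F k s.+2 h
        *m (invmx (G (k + s.+1)%N h) *m drift k.+1 s h) =
    - f 0 - \sum_(0 <= s < d) f s.+1.
  have -> : - f 0 = F k 1 h *m v k h.
    by rewrite vk mulmxN mulmxA /f addn0.
  rewrite (ric_F1 ric) // mulmxBl -addrA; congr (_ + _); rewrite -opprD; congr (- _).
  rewrite mulmx_suml -big_split; apply: eq_big_nat => s /andP[_ sd] /=.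
  rewrite drift_next // /f; move: (drift k s.+1 h) => x.
  by rewrite !mulmxDr !mulmxA.
have fd : f d = (M0 (k + d)%N h)^T *m invmx (G (k + d)%N h) *m M0 (k + d)%N h
    *m Z z0 v k h.
  rewrite /f /drift big_geq // addr0 subnK; last by lia.
  have [kdN|Nkd] := leqP (k + d) N; last first.
    by rewrite (ric_M0end ric) // trmx0 !(mul0mx, mulmx0).
  rewrite M0_adjoint; last by lia.
  by rewrite addnK -F_iter ?mulmxA //; lia.
(* The terms below d are those of the closed form; f d is the extra one. *)
have shift : f 0 + \sum_(0 <= s < d) f s.+1 = \sum_(0 <= s < d) f s + f d.
  by rewrite -big_nat_recl // -big_nat_recr.
rewrite -[X in _ + X]addrA f0 addrA -mulmxDl PE mulmxDl -fd -opprD shift.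
rewrite opprD /closed_costate -addrA; congr (_ + _).
by rewrite addrC subrK.
Qed.

End ClosedForm.

(** * The feedback law and optimality *)

Local Notation law z0 v k :=
  (forall h, v k h = - (invmx (G k h) *m drift z0 v k 0 h)).
Local Notation causal := (@causal R H m th d N).
Local Notation costate := (costate p th a b Q PN1 d N).
Local Notation gradient := (gradient p th b Rw d).
Local Notation stationary := (stationary p th b Rw d N).
Local Notation fcost := (fcost p a b Q Rw PN1 N).
Local Notation fopt := (@fopt R H q m p th a b Q Rw PN1 d N).

Lemma closed_end z0 v lam : costate z0 v lam ->
  lam N.+1 =1 closed_costate z0 v N.+1.
Proof.
move=> [_ lN] h; rewrite lN /closed_costate (ric_Pend ric) big1 ?subr0 // => s _.
by rewrite drift_end ?mulmx0 //; lia.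
Qed.

Lemma law_closed u0 z0 v lam k0 : causal u0 v -> costate z0 v lam ->
  (d <= k0)%N -> (forall k, (k0 <= k <= N)%N -> law z0 v k) ->
  forall k, (k0 <= k <= N.+1)%N -> lam k =1 closed_costate z0 v k.
Proof.
move=> cv lE dk0 fb k /andP[k0k]; rewrite leq_eqVlt => /orP[/eqP ->|kN].
  exact: closed_end.
have {k0k kN} : (k0 <= k <= N)%N by lia.
move: k; apply: down_ind => k kN IH; apply: (costate_closed cv lE).
- by lia.
- have [kN'|Nk] := leqP k.+1 N; first by apply: IH; lia.
  by (have -> : k = N by lia); apply: closed_end.
- exact: fb.
Qed.

Lemma law_gradient u0 z0 v lam k : causal u0 v ->
  (d <= k <= N)%N -> (forall h, G k h \in unitmx) ->
  lam k.+1 =1 closed_costate z0 v k.+1 ->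
  (forall h, gradient v lam k h = 0) <-> law z0 v k.
Proof.
move=> cv kN Gu lk; have gE h := gradient_closed cv h kN lk.
split=> [g0 h|fb h]; last by rewrite gE fb mulmxN mulKVmx // addNr.
have := g0 h; rewrite gE => /eqP; rewrite addr_eq0 => /eqP e.
by rewrite -mulmxN -[RHS]/(invmx (G k h) *m - drift z0 v k 0 h) -e mulKmx.
Qed.

Lemma stationary_law u0 z0 v lam : causal u0 v -> costate z0 v lam ->
  (forall k h, (d <= k <= N)%N -> G k h \in unitmx) ->
  stationary v lam <-> (forall k, (d <= k <= N)%N -> law z0 v k).
Proof.
move=> cv lE Gu; split=> [st|fb k h kN]; last first.
  apply: (law_gradient cv kN _ _).2; [by move=> ?; apply: Gu| |exact: fb].
  by apply: (law_closed cv lE (leqnn d) fb); lia.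
suff both k : (d <= k <= N)%N ->
    law z0 v k /\ lam k =1 closed_costate z0 v k by move=> k /both[].
move: k; apply: down_ind => k kN IH.
have lk : lam k.+1 =1 closed_costate z0 v k.+1.
  have [kN'|Nk] := leqP k.+1 N; first by apply: (IH k.+1 _).2; lia.
  by (have -> : k = N by lia); apply: closed_end.
have fb : law z0 v k.
  apply: (law_gradient cv kN _ lk).1 => h; first exact: Gu.
  exact: st.
by split=> //; apply: (costate_closed cv lE).
Qed.

Lemma drift_history z0 v v' k h : (d <= k)%N ->
  (forall j, (j < k)%N -> v j h = v' j h) ->
  drift z0 v k 0 h = drift z0 v' k 0 h.
Proof.
move=> dk e; rewrite /drift !addn0 (traj_ext a b z0 (v' := v')); last first.
  by move=> j jk; apply: e; lia.
by congr (_ + _); apply: eq_big_nat => i id; rewrite e //; lia.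
Qed.

(** With [k0 = d] this gives the optimal control, with [k0 = k + 1] the direction of
    perturbation in [unique_posdef]. *)
Lemma law_ex u0 z0 x k0 : causal u0 x -> (d <= k0)%N ->
  exists v, [/\ causal u0 v, forall k, (k < k0)%N -> v k = x k
    & forall k, (k0 <= k)%N -> law z0 v k].
Proof.
move=> cx dk0.
pose phi k f := if (k < k0)%N then x k else
  fun h => - (invmx (G k h) *m drift z0 f k 0 h).
have ext k f g : (forall j, (j < k)%N -> f j = g j) -> phi k f = phi k g.
  move=> e; rewrite /phi; case: ifP => // kk0; apply/funext => h.
  by congr (- (_ *m _)); apply: drift_history => [|j jk]; [lia|rewrite e].
have [v vE] := history_fix (fun=> 0) ext.
exists v; split.
- split=> [[i id] h|k].
    by rewrite vE /phi (leq_trans id dk0) (cx.1 (Ordinal id)).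
  have [r] := ubnP k; elim: r k => // r IH k kr kN.
  rewrite vE /phi; case: ifP => kk0; first exact: cx.2.
  (* Truncation makes the control causal by the induction hypothesis alone. *)
  pose w j h := if (j < k)%N then v j h else 0.
  have cw : causal u0 w.
    split=> [[i id] h|j jN]; rewrite /w.
      rewrite ifT /=; last by lia.
      by rewrite vE /phi (leq_trans id dk0) (cx.1 (Ordinal id)).
    by case jk: (j < k)%N => //; apply: IH => //; lia.
  have dE h : drift z0 v k 0 h = drift z0 w k 0 h.
    by apply: drift_history => [|j jk]; [lia|rewrite /w jk].
  move=> h h' hh; rewrite !dE.
  have -> : G k h = G k h' by apply: G_adapted hh; lia.
  by rewrite (drift_adapted z0 cw (k := k) (e := k - d) _ _ _ hh) ?addn0 //; lia.
- by move=> k kk0; rewrite vE /phi kk0.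
- by move=> k kk0 h; rewrite vE /phi ltnNge kk0.
Qed.

Lemma law_unique u0 z0 v v' : causal u0 v -> causal u0 v' ->
  (forall k, (d <= k <= N)%N -> law z0 v k) ->
  (forall k, (d <= k <= N)%N -> law z0 v' k) ->
  forall k h, (k <= N)%N -> v k h = v' k h.
Proof.
move=> cv cv' fb fb' k h; have [r] := ubnP k; elim: r k => // r IH k kr kN.
have [dk|kd] := leqP d k; last by rewrite (cv.1 (Ordinal kd)) (cv'.1 (Ordinal kd)).
rewrite fb ?fb' ?dk //; congr (- (_ *m _)).
by apply: drift_history => // j jk; apply: IH; lia.
Qed.

Lemma fopt_law u0 z0 v : (forall k h, (d <= k <= N)%N -> posdefmx (G k h)) ->
  causal u0 v -> fopt z0 u0 v <-> (forall k, (d <= k <= N)%N -> law z0 v k).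
Proof.
move=> Gpos cv; have [lam lE] := costate_ex p th a b Q PN1 d N z0 v.
have Gu k h : (d <= k <= N)%N -> G k h \in unitmx.
  by move=> kN; apply/posdef_unitmx/Gpos.
rewrite -(stationary_law cv lE Gu); split=> [opt|st].
  exact: (opt_stationary p_gt0 a_adapted b_adapted dN Q_psd Rw_psd PN1_psd opt lE).
exact: (stationary_opt p_gt0 a_adapted b_adapted dN Q_psd Rw_psd PN1_psd cv lE st).
Qed.

(** By [duality] the cost of the steps from [d] on is the pairing of the state and
    the costate at step [d], as the gradient vanishes. *)
Lemma fopt_cost u0 z0 v : (forall k h, (d <= k <= N)%N -> posdefmx (G k h)) ->
  fopt z0 u0 v -> fcost z0 v = mean p (fun h =>
    \sum_(0 <= k < d) (qform Q (Z z0 v k h) + qform Rw (v k h))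
    + ((Z z0 v d h)^T *m closed_costate z0 v d h) ord0 ord0 : R^o).
Proof.
move=> Gpos opt; have cv := opt.1.
have [lam lE] := costate_ex p th a b Q PN1 d N z0 v.
have fb := (fopt_law z0 Gpos cv).1 opt.
have lcl := law_closed cv lE (leqnn d) fb.
have st := (stationary_law cv lE (fun k h kN => posdef_unitmx (Gpos k h kN))).2 fb.
rewrite (fcost_split Rw p_gt0 a_adapted b_adapted dN cv lE).
rewrite [X in _ + X = _]big_nat_cond [X in _ + X = _]big1 ?addr0; last first.
  by move=> k /andP[kN _]; rewrite dot0r // => h; apply: st; lia.
rewrite meanD mean_sum dotE; congr (_ + _).
  by apply: eq_bigr => k _; rewrite !dot_qform meanD.
by congr (mean p _); apply/funext => h; rewrite lcl //; lia.
Qed.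

(** Otherwise the control that is zero before step [k], a nonzero vector [x] with
    [qform Gamma x <= 0] on one atom at step [k], and the feedback law afterwards
    has cost zero, and it can be added to an optimal control. *)
Lemma unique_posdef u0 z0 v : fopt z0 u0 v ->
  (forall v', fopt z0 u0 v' -> forall k h, (d <= k <= N)%N -> v' k h = v k h) ->
  forall k h, (d <= k <= N)%N -> posdefmx (G k h).
Proof.
move=> opt uniq k h kN; move: k kN h; apply: down_ind => k kN IH h0.
split=> [|x x0]; first by apply: G_sym; lia.
rewrite ltNge; apply/negP => Gx.
pose xi h := if agree th (k - d) h0 h then x else 0.
have cxi : causal (fun=> 0) (fun j h => if j == k then xi h else 0).
  split=> [[i id] h|j jN] /=; first by rewrite ifF //; lia.
  case: eqP => [->|_] // h h' hh; rewrite /xi.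
  by rewrite agree_sym (agree_eqr hh) agree_sym.
have [delta [cd d_lt fb]] := law_ex 0 cxi (k0 := k.+1) ltac:(lia).
have dk h : delta k h = xi h by rewrite d_lt // eqxx.
have d0 j h : (j < k)%N -> delta j h = 0 by move=> jk; rewrite d_lt ?ltn_eqF //; lia.
have z0' j h : (j <= k)%N -> Z 0 delta j h = 0.
  by move=> jk; apply: traj0 => i ij; apply: d0; lia.
have [mu muE] := costate_ex p th a b Q PN1 d N 0 delta.
have mucl j : (k < j <= N.+1)%N -> mu j =1 closed_costate 0 delta j.
  by move=> jN; apply: (law_closed cd muE (k0 := k.+1)) => // [|i iN];
    [lia|apply: fb; lia].
have cost_delta : fcost 0 delta = dot p xi (fun h => G k h *m xi h).
  rewrite (fcost_split Rw p_gt0 a_adapted b_adapted dN cd muE).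
  rewrite (dot0l _ _ (fun h => z0' d h ltac:(lia))) addr0.
  rewrite [X in X + _ = _]big_nat_cond [X in X + _ = _]big1 ?add0r; last first.
    move=> j /andP[jd _].
    rewrite (dot0l _ _ (fun h => z0' j h ltac:(lia))).
    by rewrite (dot0l _ _ (fun h => d0 j h ltac:(lia))) addr0.
  rewrite (bigD1_seq k) /=; [|by rewrite mem_index_iota; lia|exact: iota_uniq].
  rewrite [X in _ + X = _]big_nat_cond [X in _ + X = _]big1 ?addr0; last first.
    move=> j /andP[jN jk]; have [jk'|kj] := ltnP j k.
      by rewrite (dot0l _ _ (fun h => d0 j h jk')).
    rewrite dot0r // => h.
    apply: (law_gradient (z0 := 0) cd _ _ _).2 => [|h'||].
    - by lia.
    - by apply/posdef_unitmx/IH; lia.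
    - by apply: mucl; lia.
    - by apply: fb; lia.
  apply: eq_dot => // h; rewrite (gradient_closed (z0 := 0) cd) //; last first.
    by apply: mucl; lia.
  rewrite dk /drift !addn0 z0' ?leq_subr // mulmx0 add0r big_nat_cond big1 ?addr0 //.
  by move=> i /andP[id _]; rewrite d0 ?mulmx0 //; lia.
have cost0 : fcost 0 delta = 0.
  apply/eqP; rewrite eq_le (fcost_ge0 a b N p_gt0 Q_psd Rw_psd PN1_psd) andbT.
  rewrite cost_delta dotE /mean sumr_le0 // => h _.
  apply: mulr_ge0_le0; first exact: ltW.
  rewrite /xi; case: ifP => [hh|_]; last first.
    by rewrite trmx0 mul0mx mxE.
  rewrite -(G_adapted (k := k) _ hh); last by lia.
  by rewrite mulmxA.
have cvd : causal u0 (fun j h => v j h + 1 *: delta j h) by apply: causalDZ opt.1 cd.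
have [lam lE] := costate_ex p th a b Q PN1 d N z0 v.
have st := opt_stationary p_gt0 a_adapted b_adapted dN Q_psd Rw_psd PN1_psd opt lE.
have optd : fopt z0 u0 (fun j h => v j h + 1 *: delta j h).
  split=> // v' cv'; apply: le_trans (opt.2 _ cv').
  rewrite (fcost_variation p_gt0 a_adapted b_adapted dN Q_psd Rw_psd PN1_psd opt.1 cvd lE).
  rewrite big_nat_cond big1 ?mulr0 ?addr0; last first.
    by move=> j /andP[jN _]; rewrite dot0r // => h; apply: st; lia.
  rewrite (_ : (fun j h => v j h + 1 *: delta j h - v j h) = delta) ?cost0 ?addr0 //.
  by apply/funext => j; apply/funext => h; rewrite scale1r addrC addKr.
have := uniq _ optd k h0 kN; rewrite scale1r dk /xi agree_refl => /eqP.
by rewrite addrC -subr_eq0 addrK (negPf x0).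
Qed.

Lemma fopt_ex u0 z0 : (forall k h, (d <= k <= N)%N -> posdefmx (G k h)) ->
  exists v, fopt z0 u0 v.
Proof.
move=> Gpos.
have cx : causal u0 (fun i h => if insub i is Some j then u0 j else 0).
  split=> [i h|k kN h h' _ //]; by rewrite valK.
have [v [cv _ fb]] := law_ex z0 cx (leqnn d).
by exists v; apply/(fopt_law z0 Gpos cv) => k /andP[dk _]; apply: fb.
Qed.

Lemma fopt_unique u0 z0 v v' : (forall k h, (d <= k <= N)%N -> posdefmx (G k h)) ->
  fopt z0 u0 v -> fopt z0 u0 v' -> forall k h, (k <= N)%N -> v k h = v' k h.
Proof.
move=> Gpos opt opt'; apply: (law_unique opt.1 opt'.1).
  exact: (fopt_law z0 Gpos opt.1).1.
exact: (fopt_law z0 Gpos opt'.1).1.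
Qed.

Lemma stationary_closed u0 z0 v lam :
  (forall k h, (d <= k <= N)%N -> posdefmx (G k h)) ->
  causal u0 v -> costate z0 v lam -> stationary v lam ->
  fopt z0 u0 v /\
  forall k, (d <= k <= N.+1)%N -> lam k =1 closed_costate z0 v k.
Proof.
move=> Gpos cv lE st; split.
  exact: (stationary_opt p_gt0 a_adapted b_adapted dN Q_psd Rw_psd PN1_psd cv lE st).
apply: (law_closed cv lE (leqnn d)).
by apply/(stationary_law cv lE (fun k h kN => posdef_unitmx (Gpos k h kN))).
Qed.

End Riccati.

(** * The sigma-algebra generated by finitely many bits *)

Lemma sigma_algebra_setU (T : Type) (C : set_system T) (A B : set T) :
  sigma_algebra setT C -> C A -> C B -> C (A `|` B).
Proof.
move=> [C0 _ CU] CA CB; rewrite -bigcup2E; apply: CU => -[|[|i]] //=.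
Qed.

Lemma sigma_algebra_setC (T : Type) (C : set_system T) (A : set T) :
  sigma_algebra setT C -> C A -> C (~` A).
Proof. by move=> [_ CC _] CA; rewrite -setTD; apply: CC. Qed.

Lemma sigma_algebra_setI (T : Type) (C : set_system T) (A B : set T) :
  sigma_algebra setT C -> C A -> C B -> C (A `&` B).
Proof.
move=> sC CA CB; rewrite -[_ `&` _]setCK setCI; apply: sigma_algebra_setC => //.
by apply: sigma_algebra_setU => //; apply: sigma_algebra_setC.
Qed.

(** By induction on [k]: the last bit cuts [A] into two pieces, each of which is
    the trace of a set that is saturated for the previous bits. *)
Lemma sigma_algebra_adapted (T : Type) (th : nat -> T -> bool) (C : set_system T) k
    (A : set T) : sigma_algebra setT C ->
  (forall i, (i < k)%N -> C [set w | th i w]) -> adapted th k A -> C A.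
Proof.
move=> sC; elim: k A => [|k IH] A thC hA.
  have [[w Aw]|A0] := pselect (A !=set0).
    have -> : A = ~` set0.
      rewrite setC0; apply/seteqP; split=> // w' _.
      by rewrite -(hA w) //; apply/agreeP.
    by apply: sigma_algebra_setC => //; case: sC.
  have -> : A = set0 by apply/seteqP; split=> // w Aw; case: A0; exists w.
  by case: sC.
(* Saturating a piece for the first k bits forgets the last one. *)
pose slice c := [set w | exists w', [/\ A w', agree th k w w' & th k w' = c]].
have sliceC c : C (slice c).
  apply: IH => [i ik|w w' ww']; first by apply: thC; lia.
  apply/propext; split=> -[u [Au wu thu]]; exists u; split=> //.
    by apply: agree_trans wu; rewrite agree_sym.
  exact: agree_trans wu.
have -> : A = (slice true `&` [set w | th k w])
    `|` (slice false `&` ~` [set w | th k w]).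
  apply/seteqP; split=> [w Aw|w].
    case e: (th k w); [left|right].
      by split=> //; exists w; split=> //; exact: agree_refl.
    by split=> /=; [exists w; split=> //; exact: agree_refl|rewrite e].
  have merge u : A u -> agree th k w u -> th k u = th k w -> A w.
    move=> Au wu e; rewrite (hA w u) //; apply/agreeP => i; rewrite ltnS leq_eqVlt.
    by move=> /orP[/eqP ->//|]; move/agreeP: wu; apply.
  move=> [[[u [Au wu thu]] /= thw]|[[u [Au wu thu]] /= /negP/negbTE thw]].
    by apply: merge wu _ => //; rewrite thu thw.
  by apply: merge wu _ => //; rewrite thu thw.
have thk := thC k (ltnSn k).
apply: sigma_algebra_setU => //; apply: sigma_algebra_setI => //.
exact: sigma_algebra_setC.
Qed.

Section Past.
Context {disp : measure_display} {T : measurableType disp} {R : realType}.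
Variables (P : probability T R) (theta : nat -> {RV P >-> bool}).

Local Notation th := (fun i w => theta i w : bool).

Lemma past_sigma k : sigma_algebra setT (past theta k).
Proof. exact: smallest_sigma_algebra. Qed.

Lemma past_adapted k (A : set T) : past theta k A -> adapted th k A.
Proof.
move: A; apply: smallest_sub.
  split=> [//|A hA w w' ww'|F hF w w' ww'].
    by rewrite /setD /mkset (hA _ _ ww').
  apply/propext; split=> -[i _ Fi]; exists i => //.
    by rewrite -(hF i _ _ ww').
  by rewrite (hF i _ _ ww').
move=> _ [i /= ik [B _ <-]] w w' ww'.
by rewrite /setI /preimage /=; move/agreeP: ww' => /(_ i ik) ->.
Qed.

Lemma adapted_past k (A : set T) : adapted th k A -> past theta k A.
Proof.
apply: sigma_algebra_adapted; first exact: past_sigma.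
move=> i ik; apply: sub_sigma_algebra; exists i => //=.
by exists [set true] => //; apply/seteqP; split=> w //= [].
Qed.

Lemma adapted_measurable k (A : set T) : adapted th k A -> measurable A.
Proof.
apply: sigma_algebra_adapted => [|i _]; first exact: sigma_algebra_measurable.
rewrite (_ : [set w | _] = theta i @^-1` [set true]) //.
exact: measurable_funPTI.
Qed.

Lemma sub_measurableP k (X : T -> R) :
  sub_measurable (past theta k) X <-> adapted th k X.
Proof.
split=> [hX w w' ww'|hX _ [B mB <-]]; last first.
  by apply: adapted_past => w w' ww'; rewrite /setI /preimage /= (hX _ _ ww').
have : past theta k (setT `&` X @^-1` [set X w]).
  by apply: hX; exists [set X w] => //; exact: measurable_set1.
move=> /past_adapted/(_ _ _ ww') e.
by have [_ ->] : (setT `&` X @^-1` [set X w]) w' by rewrite -e.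
Qed.

Lemma sub_measurable_mxP k a b (X : T -> 'M[R]_(a, b)) :
  sub_measurable_mx (past theta k) X <-> adapted th k X.
Proof.
split=> [hX w w' ww'|hX i j].
  by apply/matrixP => i j; have /sub_measurableP h := hX i j; exact: h.
by apply/sub_measurableP => w w' ww'; rewrite (hX _ _ ww').
Qed.

(** When no version exists, [cond_exp] is constant. *)
Lemma cond_exp_adapted k (X : T -> R) :
  adapted th k (cond_exp P (past theta k) X).
Proof.
apply/sub_measurableP; rewrite /cond_exp.
case: xgetP => [Y _ [hY _ _]//|_].
by apply/sub_measurableP.
Qed.

Lemma Epast_adapted k a b (X : T -> 'M[R]_(a, b)) :
  adapted th k (Epast theta k X).
Proof.
move=> w w' ww'; apply/matrixP => i j; rewrite !mxE.
exact: (cond_exp_adapted _ ww').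
Qed.

End Past.

(** * The finite space of paths of positive probability *)

Section Paths.
Context {disp : measure_display} {T : measurableType disp} {R : realType}.
Variables (P : probability T R) (theta : nat -> {RV P >-> bool}) (K : nat).

Local Notation th := (fun i w => theta i w : bool).

Definition code (w : T) : {ffun 'I_K -> bool} := [ffun i : 'I_K => theta i w].

Definition path_prob (f : {ffun 'I_K -> bool}) : R :=
  fine (P [set w | code w = f]).

(** Only the paths of positive probability are kept, since versions of conditional
    expectations are determined on these. *)
Definition scenario : finType := {f : {ffun 'I_K -> bool} | 0 < path_prob f}.

Definition pathp (h : scenario) : R := path_prob (val h).

Lemma pathp_gt0 h : 0 < pathp h. Proof. exact: valP h. Qed.

Lemma codeP w w' : reflect (code w = code w') (agree th K w w').
Proof.
apply: (iffP (@agreeP _ th K w w')) => [e|e i iK].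
  by apply/ffunP => i; rewrite !ffunE; apply: e.
by have /ffunP/(_ (Ordinal iK)) := e; rewrite !ffunE.
Qed.

Lemma measurable_code f : measurable [set w | code w = f].
Proof.
by apply: (@adapted_measurable _ _ _ _ theta K) => w w' /codeP ww' /=; rewrite ww'.
Qed.

Lemma path_prob_ge0 f : 0 <= path_prob f.
Proof. by rewrite fine_ge0 // measure_ge0. Qed.

Lemma path_probE f : P [set w | code w = f] = (path_prob f)%:E.
Proof.
by rewrite /path_prob fineK // fin_num_measure //; exact: measurable_code.
Qed.

Lemma path_inhabited (h : scenario) : exists w, code w = val h.
Proof.
have [//|no] := pselect (exists w, code w = val h).
have := pathp_gt0 h; rewrite /pathp /path_prob.
rewrite (_ : [set w | _] = set0) ?measure0 ?ltxx //.
by apply/seteqP; split=> // w /= e; apply: no; exists w.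
Qed.

Definition rep (h : scenario) : T := projT1 (cid (path_inhabited h)).

Lemma code_rep h : code (rep h) = val h.
Proof. by rewrite /rep; case: cid. Qed.

Definition path_th (i : nat) (h : scenario) : bool := theta i (rep h).

(** The value of [X] on all paths, including those that no outcome realises and
    those of probability zero, where [rep] gives nothing. *)
Definition path_val (X : T -> R) (f : {ffun 'I_K -> bool}) : R :=
  if pselect (exists w, code w = f) is left e then X (projT1 (cid e)) else 0.

Lemma path_valE X w : adapted th K X -> path_val X (code w) = X w.
Proof.
move=> hX; rewrite /path_val; case: pselect => [e|]; last by case; exists w.
by apply: hX; apply/codeP; case: cid.
Qed.

Lemma path_integrable_integral (X : T -> R) : adapted th K X ->
  P.-integrable setT (EFin \o X) /\
  (\int[P]_w (X w)%:E = (mean pathp (fun h => X (rep h) : R^o))%:E)%E.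
Proof.
move=> hX;
  pose g f w : \bar R := ((path_val X f)%:E * (\1_[set w | code w = f] w)%:E)%E.
have XE : EFin \o X = fun w => (\sum_f g f w)%E.
  apply/funext => w /=; rewrite (bigD1 (code w)) //= big1 ?adde0; last first.
    move=> f fw; rewrite /g indicE memNset ?mule0 //= => e.
    by rewrite e eqxx in fw.
  by rewrite /g indicE mem_set // mule1 path_valE.
have ig f : P.-integrable setT (g f).
  by apply: integrableZl => //; apply: integrable_indic; exact: measurable_code.
split; first by rewrite XE; apply: integrable_sum.
rewrite [LHS](_ : _ = \int[P]_w (\sum_f g f w))%E; last by rewrite -XE.
rewrite integral_sum //.
transitivity (\sum_f (path_val X f * path_prob f)%:E)%E.
  apply: eq_bigr => f _; rewrite integralZl //; last first.
    by apply: integrable_indic; exact: measurable_code.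
  rewrite integral_indic ?setIT //; last exact: measurable_code.
  by rewrite [X in (_ * X)%E]path_probE EFinM.
transitivity ((\sum_f path_val X f * path_prob f)%:E); first exact: sumEFin.
congr EFin.
rewrite (bigID (fun f => 0 < path_prob f)) /= [X in _ + X]big1 ?addr0; last first.
  move=> f; rewrite lt_neqAle path_prob_ge0 andbT negbK => /eqP <-.
  by rewrite mulr0.
rewrite (big_sub [pred f | 0 < path_prob f]).
apply: eq_bigr => h _; rewrite -code_rep path_valE // mulrC.
by rewrite code_rep.
Qed.

Lemma ae_path (C : T -> Prop) : adapted th K C ->
  {ae P, forall w, C w} <-> (forall h, C (rep h)).
Proof.
move=> hC; split=> [[B [mB PB CB]] h|Ch].
  have [//|nC] := pselect (C (rep h)).
  have : (P [set w | code w = val h] <= P B)%E.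
    apply: le_measure; rewrite ?inE //; first exact: measurable_code.
    move=> w /= cw; apply: CB => /=; rewrite (hC w (rep h)) //.
    by apply/codeP; rewrite code_rep.
  by rewrite PB path_probE lee_fin leNgt pathp_gt0.
have hC' : adapted th K (fun w => \1_(~` C) w : R).
  move=> w w' ww'; rewrite !indicE; congr ((nat_of_bool _)%:R).
  by apply/idP/idP => /set_mem h; apply/mem_set; move: h;
    rewrite /setC /= (hC _ _ ww').
have mC : measurable (~` C).
  apply: (@adapted_measurable _ _ _ _ theta K) => w w' ww'.
  by rewrite /setC /= (hC _ _ ww').
apply/negligibleP; first exact: mC.
have [_] := path_integrable_integral hC'.
rewrite integral_indic // setIT => PC; apply: (etrans PC); congr EFin.
apply: big1 => h _.
by rewrite indicE memNset ?scaler0 //; apply.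
Qed.

(** [X] is evaluated at some scenario that agrees with the outcome on the first
    [k] bits.  Outcomes that agree on these bits see the same scenarios, so the
    extension is adapted at all outcomes, also on null paths. *)
Lemma path_lift (V : Type) (x0 : V) k (X : scenario -> V) : adapted path_th k X ->
  exists Y : T -> V, adapted th k Y /\ forall h, Y (rep h) = X h.
Proof.
move=> hX.
exists (fun w => if [pick h | agree th k w (rep h)] is Some h then X h else x0).
split=> [w w' ww'|h].
  by rewrite (eq_pick (fun h => agree_eqr ww' (rep h))).
case: pickP => [h' hh'|/(_ h)]; last by rewrite agree_refl.
by apply: hX; rewrite agree_sym.
Qed.

Lemma path_integral_past k (A : set T) (X : T -> R) : (k <= K)%N ->
  past theta k A -> adapted th K X ->
  (\int[P]_(w in A) (X w)%:E
    = (mean pathp (fun h => \1_A (rep h) *: (X (rep h) : R^o)))%:E)%E.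
Proof.
move=> kK /past_adapted hA hX; rewrite integral_mkcond.
have h1 : adapted th K (fun w => \1_A w * X w).
  move=> w w' ww'; rewrite (hX _ _ ww') !indicE; congr ((nat_of_bool _)%:R * _).
  by apply/idP/idP => /set_mem h; apply/mem_set; move: h;
    rewrite (hA _ _ (agree_le kK ww')).
rewrite -(path_integrable_integral h1).2; apply: eq_integral => w _.
by rewrite /patch indicE; case: ifP => _; rewrite ?mul1r ?mul0r.
Qed.

(** The lift of the average is a version of the conditional expectation.  Any
    version takes the same value at a path of positive probability, as integration
    over the atom of the path shows. *)
Lemma cond_exp_path k (X : T -> R) h : (k <= K)%N -> adapted th K X ->
  cond_exp P (past theta k) X (rep h)
    = condE pathp path_th k (fun h => X (rep h) : R^o) h.
Proof.
move=> kK hX; pose cX := condE pathp path_th k (fun h => X (rep h) : R^o).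
have past_indic A : past theta k A -> adapted path_th k (fun h => \1_A (rep h) : R).
  move=> /past_adapted hA h1 h2 hh; rewrite !indicE; congr ((nat_of_bool _)%:R).
  by apply/idP/idP => /set_mem e; apply/mem_set; move: e; rewrite (hA _ _ hh).
have pull A : past theta k A -> mean pathp (fun h => \1_A (rep h) *: cX h)
    = mean pathp (fun h => \1_A (rep h) *: (X (rep h) : R^o)).
  move=> hA; rewrite -[RHS](mean_condE path_th pathp_gt0 k).
  congr (mean _ _); apply/funext => h1; rewrite /cX /condE !scaler_sumr.
  apply: eq_bigr => h2 hh; rewrite (past_indic _ hA _ _ hh) !scalerA.
  by congr (_ *: _); rewrite -mulrA mulrC.
have [Z [hZ ZE]] := path_lift (0 : R) (condE_adapted pathp (fun h => X (rep h) : R^o)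
  : adapted path_th k cX).
have ex : exists Y, is_cond_exp P (past theta k) X Y.
  exists Z; split; first exact/sub_measurableP.
    exact: (path_integrable_integral (adapted_le hZ kK)).1.
  move=> A hA; rewrite !(path_integral_past kK hA) //; last exact: adapted_le hZ kK.
  congr EFin; rewrite -pull //; congr (mean _ _); apply/funext => h1.
  by rewrite ZE.
have [/sub_measurableP hY _ intY] := xgetPex (cst 0) ex.
set Y := xget _ _ in hY intY; rewrite -[LHS]/(Y (rep h)).
(* A version is constant on the atom of the path. *)
pose A := [set w | agree th k (rep h) w].
have hA : past theta k A.
  apply: adapted_past => w w' ww'; rewrite /A /= agree_sym (agree_eqr ww').
  by rewrite agree_sym.
have := intY A hA; rewrite !(path_integral_past kK hA) //;
  last exact: adapted_le hY kK.
move=> [] e.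
have restrict (W : T -> R) : mean pathp (fun h => \1_A (rep h) *: (W (rep h) : R^o))
    = \sum_(h' | agree path_th k h h') pathp h' *: (W (rep h') : R^o).
  rewrite /mean [RHS]big_mkcond /=; apply: eq_bigr => h' _; rewrite indicE.
  case: ifP => hh; first by rewrite mem_set // scale1r.
  by rewrite memNset ?scale0r ?scaler0 //; move/negbT/negP: hh; apply.
move: e; rewrite !restrict => e; rewrite /condE -e.
have -> : \sum_(h' | agree path_th k h h') pathp h' *: (Y (rep h') : R^o) =
    weight pathp path_th k h *: (Y (rep h) : R^o).
  rewrite scaler_suml; apply: eq_bigr => h' hh.
  by rewrite (hY (rep h) (rep h') hh).
by rewrite scalerA mulVf ?scale1r // gt_eqF // weight_gt0 //; exact: pathp_gt0.
Qed.

Lemma Epast_path k a b (X : T -> 'M[R]_(a, b)) h : (k <= K)%N ->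
  adapted th K X ->
  Epast theta k X (rep h) = condE pathp path_th k (fun h => X (rep h)) h.
Proof.
move=> kK hX; apply/matrixP => i j; rewrite !mxE cond_exp_path //; last first.
  by move=> w w' ww'; rewrite (hX _ _ ww').
rewrite /condE summxE; congr (_ * _).
by apply: eq_bigr => h' _; rewrite mxE.
Qed.

Lemma expectation_path (X : T -> R) : adapted th K X ->
  ('E_P[X] = (mean pathp (fun h => X (rep h) : R^o))%:E)%E.
Proof. by move=> hX; rewrite unlock (path_integrable_integral hX).2. Qed.

End Paths.

(** * Transfer of the control problem *)

Section Transfer.
Context {disp : measure_display} {T : measurableType disp} {R : realType}.
Variables (P : probability T R) (n m d N : nat).
Hypothesis dN : (d <= N)%N.
Variables (theta : nat -> {RV P >-> bool}).
Variables (A : 'M[R]_n) (B : 'M[R]_(n, m)).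
Variables (Q : 'M[R]_(n + m)) (Rw : 'M[R]_m) (PN1 : 'M[R]_(n + m)).

Local Notation K := N.+1.
Local Notation th := (fun i w => theta i w : bool).
Local Notation H := (scenario theta K).
Local Notation rep := (@rep _ _ _ P theta K).
Local Notation pp := (@pathp _ _ _ P theta K).
Local Notation pth := (@path_th _ _ _ P theta K).
Local Notation z := (state theta A B).
Local Notation G := (Gamma theta A B Q Rw PN1 d N).
Local Notation Pb := (Pbar theta A B Q Rw PN1 d N).
Local Notation M0 := (M0 theta A B Q Rw PN1 d N).
Local Notation M := (M theta A B Q Rw PN1 d N).
Local Notation F := (Fmx theta A B Q Rw PN1 d N).
Local Notation S := (Stilde theta A B Q Rw PN1 d N).
Local Notation at_rep X := (fun k h => X k (rep h)).

Implicit Types uinit : 'I_d -> 'cV[R]_m.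

Definition path_A (k : nat) (h : H) : 'M[R]_(n + m) := Abar A B (theta k (rep h)).
Definition path_B (k : nat) (h : H) : 'M[R]_(n + m, m) := Bbar B (theta k (rep h)).

Lemma theta_adapted i k : (i < k)%N -> adapted th k (theta i).
Proof. by move=> ik w w' /agreeP; apply. Qed.

Lemma path_A_adapted k : adapted pth k.+1 (path_A k).
Proof. by move=> h h' hh; rewrite /path_A (theta_adapted (ltnSn k) hh). Qed.

Lemma path_B_adapted k : adapted pth k.+1 (path_B k).
Proof. by move=> h h' hh; rewrite /path_B (theta_adapted (ltnSn k) hh). Qed.

Lemma Aprod_adapted i j k : (j <= k)%N -> adapted th k (Aprod theta A B i j).
Proof.
move=> jk; apply: adapted_bigop => t; rewrite mem_rev mem_index_iota => tj.
by move=> w w' ww'; rewrite (theta_adapted _ ww') //; lia.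
Qed.

Lemma state_path z0 v k h :
  z z0 v k (rep h) = traj path_A path_B z0 (at_rep v) k h.
Proof. by elim: k => [//|k /= ->]. Qed.

Lemma Gamma_adapted k : (d <= k)%N -> adapted th (k - d) (G k).
Proof.
move=> dk w w' ww'; have [kN|Nk] := leqP k N.
  by rewrite GammaE ?dk // (Epast_adapted _ ww').
by rewrite /Gamma recursion_end.
Qed.

Lemma recursion_M0_adapted k : (d <= k)%N -> adapted th (k - d) (M0 k).
Proof.
move=> dk w w' ww'; have [kN|Nk] := leqP k N; last by rewrite M0_end.
by rewrite M0E ?dk // (Epast_adapted _ ww').
Qed.

Lemma recursion_M_adapted k i : (d <= k)%N -> (1 <= i <= k)%N -> adapted th (k - d) (M k i).
Proof.
move=> dk /andP[i1 ik] w w' ww'.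
have [kN|Nk] := leqP k N; last by rewrite M_end.
have [id|di] := leqP i d.
  by rewrite M_leE ?dk ?i1 // (Epast_adapted _ ww').
by rewrite M_gtE ?dk ?di // (Epast_adapted _ ww') (recursion_M0_adapted dk ww').
Qed.

Lemma Stilde_adapted k : adapted th k (S k).
Proof. exact: Epast_adapted. Qed.

Lemma Pbar_adapted k : (d <= k <= N.+1)%N -> adapted th k (Pb k).
Proof.
move=> /andP[dk kN] w w' ww'; have [kN'|Nk] := leqP k N.
  by rewrite PbarE ?dk // (Epast_adapted _ ww').
by (have -> : k = N.+1 by lia); rewrite PbarN.
Qed.

Lemma Fmx_adapted k i : (d <= k <= N)%N -> (1 <= i)%N -> adapted th k (F k i).
Proof.
move=> /andP[dk kN] i1; have Fge j : (2 <= j)%N -> adapted th k (F k j).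
  by move=> j2 w w' ww'; rewrite Fmx_geE // (Epast_adapted _ ww').
have [i2|i2] := leqP 2 i; first exact: Fge.
have -> : i = 1%N by lia.
move=> w w' ww'; rewrite Fmx1E // (Stilde_adapted ww'); congr (_ - _).
apply: eq_big_nat => j jd; rewrite (Fge j.+2 isT _ _ ww').
rewrite (adapted_le (Gamma_adapted (k := k + j.+1) _) _ ww'); [|by lia..].
by rewrite (adapted_le (recursion_M_adapted (k := k + j.+1) (i := j.+1) _ _) _ ww') //; lia.
Qed.

Lemma M_gain_adapted k i : (d <= k <= N)%N -> (i < d)%N ->
  adapted th K (fun w => (M (k + i.+1) i.+1 w)^T *m invmx (G (k + i.+1) w)).
Proof.
move=> kN id; have iK : (k + i.+1 - d <= K)%N by lia.
apply: adapted2; apply: adapted1.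
  by apply: adapted_le (recursion_M_adapted _ _) iK; lia.
by apply: adapted_le (Gamma_adapted _) iK; lia.
Qed.

Lemma theta_adaptedK k : (k <= N)%N -> adapted th K (theta k).
Proof. by move=> kN; apply: theta_adapted. Qed.

Lemma Pbar_adaptedK k : (d <= k <= N)%N -> adapted th K (Pb k.+1).
Proof. by move=> kN; apply: adapted_le (Pbar_adapted _) _; lia. Qed.

(** Everything inside the conditional expectations depends on the first [N + 1]
    bits only, so that [Epast_path] applies to each equation of the recursion. *)
Lemma riccati_path : riccati pp pth path_A path_B Q Rw PN1 d N
  (at_rep Pb) (at_rep G) (at_rep M0) (fun k i h => M k i (rep h)) (at_rep S)
  (fun k i h => F k i (rep h)).
Proof.
have th_eq k w w' : (k <= N)%N -> agree th K w w' -> theta k w = theta k w'.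
  by move=> kN /(theta_adaptedK kN).
have pb_eq k w w' : (d <= k <= N)%N -> agree th K w w' -> Pb k.+1 w = Pb k.+1 w'.
  by move=> kN /(Pbar_adaptedK kN).
have M0_eq k w w' : (d <= k <= N + d)%N -> agree th K w w' -> M0 k w = M0 k w'.
  move=> kN; move: w w'; have kK : (k - d <= K)%N by lia.
  by apply: adapted_le (recursion_M0_adapted _) kK; lia.
have S_eq k w w' : (k <= N)%N -> agree th K w w' -> S k w = S k w'.
  by move=> kN; move: w w'; apply: adapted_le (@Stilde_adapted k) _; lia.
split=> [h|k h Nk|k h Nk|k i h Nk|k h kN|k h kN|k h kN|k i h kN id
  |k i h kN ik|k h kN|k h kN|k i h kN i2].
- by rewrite PbarN.
- by rewrite /Gamma recursion_end.
- by rewrite M0_end.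
- by rewrite M_end.
- rewrite StildeE Epast_path //; [by lia|].
  by move=> w w' e; rewrite (th_eq k _ _ _ e) ?(pb_eq k _ _ _ e) //; lia.
- rewrite GammaE // Epast_path //; [by lia|].
  move=> w w' e; rewrite (th_eq k _ _ _ e) ?(pb_eq k _ _ _ e) //; last by lia.
  congr (_ - _); apply: eq_big_nat => i id.
  rewrite (M_gain_adapted kN id e); congr (_ *m _).
  by apply: (adapted_le (recursion_M_adapted (k := k + i.+1) (i := i.+1) _ _) _ e);
    lia.
- rewrite M0E // Epast_path //; [by lia|].
  move=> w w' e; rewrite (S_eq k _ _ _ e); last by lia.
  rewrite (Aprod_adapted _ _ e); last by lia.
  congr (_ - _); apply: eq_big_nat => i id.
  rewrite (M_gain_adapted kN id e) (M0_eq _ _ _ _ e); last by lia.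
  by rewrite (Aprod_adapted _ _ e) //; lia.
- rewrite M_leE // Epast_path //; [by lia|].
  move=> w w' e; rewrite (S_eq k _ _ _ e); last by lia.
  rewrite (Aprod_adapted _ _ e); last by lia.
  rewrite (th_eq _ _ _ _ e); last by lia.
  congr (_ - _); apply: eq_big_nat => s sd.
  rewrite (M_gain_adapted kN sd e); congr (_ *m _).
  by apply: (adapted_le (recursion_M_adapted (k := k + s.+1) (i := i + s.+1) _ _) _ e); lia.
- rewrite M_gtE // Epast_path //; [by lia|].
  move=> w w' e; rewrite (Aprod_adapted _ _ e); last by lia.
  by rewrite (th_eq _ _ _ _ e) //; lia.
- rewrite PbarE // Epast_path //; [by lia|].
  move=> w w' e; rewrite (th_eq k _ _ _ e) ?(pb_eq k _ _ _ e) //; last by lia.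
  rewrite (M0_eq _ _ _ _ e); last by lia.
  by rewrite (adapted_le (Gamma_adapted (k := k + d) _) _ e) //; lia.
- by rewrite Fmx1E //; lia.
- rewrite Fmx_geE //; [|by lia]; rewrite Epast_path //; [by lia|].
  move=> w w' e; rewrite (th_eq k _ _ _ e); last by lia.
  congr (_ *m _); have [kN'|Nk] := leqP k.+1 N; last first.
    have -> : k = N by lia.
    by rewrite /Fmx subnn.
  by apply: (adapted_le (Fmx_adapted (k := k.+1) _ _) _ e); lia.
Qed.

Lemma admissible_adapted uinit v j k : admissible theta N uinit v ->
  (j <= N)%N -> (j - d <= k)%N -> adapted th k (v j).
Proof.
move=> [v0 va] jN jk; have [dj|jd] := leqP d j.
  apply: adapted_le jk; apply/sub_measurable_mxP.
  by apply: va; rewrite dj.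
by move=> w w' _; rewrite (v0 (Ordinal jd) w) (v0 (Ordinal jd) w').
Qed.

Lemma state_adapted uinit v z0 k : admissible theta N uinit v ->
  (k <= N.+1)%N -> adapted th k (z z0 v k).
Proof.
move=> av; elim: k => [//|k IH] kN w w' e /=.
rewrite (theta_adapted (ltnSn k) e) (adapted_le (IH _) _ e); [|by lia..].
by rewrite (admissible_adapted av _ _ e) //; lia.
Qed.

Lemma admissible_causal uinit v : admissible theta N uinit v ->
  causal pth N uinit (at_rep v).
Proof.
move=> av; split=> [i h|k kN]; first exact: av.1.
by move=> h h'; apply: (admissible_adapted av); lia.
Qed.

Lemma causal_lift uinit v : causal pth N uinit v ->
  exists v', admissible theta N uinit v' /\
    forall k h, (k <= N)%N -> v' k (rep h) = v k h.
Proof.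
move=> [v0 va].
have lift k : exists Y : T -> 'cV[R]_m,
    [/\ (d <= k <= N)%N -> adapted th (k - d) Y,
        (k <= N)%N -> forall h, Y (rep h) = v k h
      & forall i : 'I_d, i = k :> nat -> forall w, Y w = uinit i].
  have [kd|dk] := ltnP k d.
    exists (fun=> uinit (Ordinal kd)); split=> [||i ik w].
    - by lia.
    - by move=> _ h; rewrite (v0 (Ordinal kd)).
    - by congr uinit; apply: val_inj.
  have [kN|Nk] := leqP k N.
    have [|Y [hY YE]] := path_lift (0 : 'cV[R]_m) (va k _); first by rewrite dk.
    exists Y; split=> // i ik; have := ltn_ord i; lia.
  exists (fun=> 0); split; [by lia|by lia|].
  by move=> i ik; have := ltn_ord i; lia.
have [Y hY] := choice lift.
exists Y; split; last by move=> k h kN; have [_ + _] := hY k; apply.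
split=> [i w|k kN]; first by have [_ _] := hY i; apply.
by apply/sub_measurable_mxP; have [+ _ _] := hY k; apply.
Qed.

Lemma fcost_eq z0 v v' : (forall k h, (k <= N)%N -> v k h = v' k h) ->
  fcost pp path_A path_B Q Rw PN1 N z0 v = fcost pp path_A path_B Q Rw PN1 N z0 v'.
Proof.
move=> e; rewrite /fcost; congr (mean _ _); apply/funext => h.
rewrite (@traj_ext _ _ _ _ _ _ _ _ v' N.+1) => [|j jN]; last by apply: e; lia.
congr (_ + _); apply: eq_big_nat => k kN; rewrite e //.
by rewrite (@traj_ext _ _ _ _ _ _ _ _ v' k) // => j jk; apply: e; lia.
Qed.

Local Notation fopt := (@fopt R H _ m pp pth path_A path_B Q Rw PN1 d N).

Lemma fopt_eq z0 uinit v v' : causal pth N uinit v' ->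
  (forall k h, (k <= N)%N -> v k h = v' k h) ->
  fopt z0 uinit v -> fopt z0 uinit v'.
Proof.
by move=> cv' e [cv opt]; split=> // u cu; rewrite -(fcost_eq _ e); apply: opt.
Qed.

Lemma cost_path uinit z0 v : admissible theta N uinit v ->
  cost theta A B Q Rw PN1 N z0 v =
  (fcost pp path_A path_B Q Rw PN1 N z0 (at_rep v))%:E.
Proof.
move=> av; rewrite /cost (@expectation_path _ _ _ P theta K).
  congr EFin; congr (mean _ _); apply/funext => h; rewrite state_path.
  by congr (_ + _); apply: eq_bigr => k _; rewrite state_path.
move=> w w' e; rewrite (state_adapted z0 av (leqnn _) e); congr (_ + _).
apply: eq_big_nat => k kN.
rewrite (adapted_le (state_adapted z0 av _) _ e); [|by lia..].
by rewrite (admissible_adapted av _ _ e) //; lia.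
Qed.

Lemma optimal_path z0 uinit v : admissible theta N uinit v ->
  optimal theta A B Q Rw PN1 N z0 uinit v <-> fopt z0 uinit (at_rep v).
Proof.
move=> av; split=> [[_ opt]|[_ opt]].
  split=> [|u /causal_lift[v' [av' e]]]; first exact: admissible_causal.
  rewrite -lee_fin -(cost_path z0 av) -(fcost_eq _ e) -(cost_path z0 av').
  exact: opt.
split=> // v' av'; rewrite (cost_path z0 av) (cost_path z0 av') lee_fin.
by apply: opt; exact: admissible_causal.
Qed.

Lemma Gamma_posdef_path :
  (forall k, (d <= k <= N)%N -> {ae P, forall w, posdefmx (G k w)}) <->
  (forall k h, (d <= k <= N)%N -> posdefmx (G k (rep h))).
Proof.
have gK k : (d <= k <= N)%N -> adapted th K (fun w => posdefmx (G k w)).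
  by move=> kN; apply: adapted1; apply: adapted_le (Gamma_adapted _) _; lia.
split=> hG k => [h kN|kN]; have := hG k.
  by move=> /(_ kN)/(ae_path (gK k kN)).
by move=> hk; apply/(ae_path (gK k kN)) => h; apply: hk.
Qed.

(** * The parts of the theorem *)

Hypothesis Q_psd : possemidefmx Q.
Hypothesis Rw_psd : possemidefmx Rw.
Hypothesis PN1_psd : possemidefmx PN1.

Local Notation optimal := (optimal theta A B Q Rw PN1 N).
Local Notation posdef_all :=
  (forall k, (d <= k <= N)%N -> {ae P, forall w, posdefmx (G k w)}).

Let pos := @pathp_gt0 _ _ _ P theta K.
Let Aad := @path_A_adapted.
Let Bad := @path_B_adapted.
Let ric := riccati_path.

Lemma unique_solution_posdef z0 uinit :
  has_unique_solution theta A B Q Rw PN1 N z0 uinit <-> posdef_all.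
Proof.
rewrite Gamma_posdef_path; split=> [[[v opt] uniq] k h kN|Gpos].
  have av := opt.1; have fo := (optimal_path z0 av).1 opt.
  apply: (unique_posdef pos Aad Bad dN Q_psd Rw_psd PN1_psd ric fo) kN.
  move=> u fu j h' jN; have [u' [au ue]] := causal_lift fu.1.
  have opt' : optimal z0 uinit u'.
    apply/(optimal_path z0 au); apply: fopt_eq fu; first exact: admissible_causal.
    by move=> i h2 iN; rewrite ue.
  have jN' : (j <= N)%N by lia.
  rewrite -ue //; move: h'; apply/(ae_path (C := fun w => u' j w = v j w)).
    apply: adapted2; first by apply: (admissible_adapted au); lia.
    by apply: (admissible_adapted av); lia.
  exact: uniq.
split.
  have [u fu] := fopt_ex pos Aad Bad dN Q_psd Rw_psd PN1_psd ric uinit z0 Gpos.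
  have [v [av ve]] := causal_lift fu.1.
  exists v; apply/(optimal_path z0 av); apply: fopt_eq fu;
    first exact: admissible_causal.
  by move=> k h kN; rewrite ve.
move=> v v' opt opt' k kN; apply/(@ae_path _ _ _ _ theta K) => [|h].
  apply: adapted2; first by apply: (admissible_adapted opt.1); lia.
  by apply: (admissible_adapted opt'.1); lia.
apply: (fopt_unique pos Aad Bad dN Q_psd Rw_psd PN1_psd ric Gpos (z0 := z0) (u0 := uinit)
  (v := at_rep v) (v' := at_rep v')); last by lia.
- exact/(optimal_path z0 opt.1).
- exact/(optimal_path z0 opt'.1).
Qed.

Lemma state_adaptedK uinit v z0 k : admissible theta N uinit v ->
  (k <= N.+1)%N -> adapted th K (z z0 v k).
Proof. by move=> av kN; apply: adapted_le (state_adapted z0 av kN) kN. Qed.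

Lemma admissible_adaptedK uinit v k : admissible theta N uinit v ->
  (k <= N)%N -> adapted th K (v k).
Proof. by move=> av kN; apply: (admissible_adapted av); lia. Qed.

Lemma optimal_feedback z0 uinit v : posdef_all -> admissible theta N uinit v ->
  optimal z0 uinit v <-> forall k, (d <= k <= N)%N -> {ae P, forall w,
    v k w = - (invmx (G k w) *m (M0 k w *m z z0 v (k - d)%N w
       + \sum_(1 <= i < d.+1) M k i w *m v (k - i)%N w))}.
Proof.
move=> /Gamma_posdef_path Gpos av; rewrite optimal_path //.
rewrite (fopt_law pos Aad Bad dN Q_psd Rw_psd PN1_psd ric z0 Gpos); last first.
  exact: admissible_causal.
have law_at k : (d <= k <= N)%N -> {ae P, forall w,
    v k w = - (invmx (G k w) *m (M0 k w *m z z0 v (k - d)%N w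
       + \sum_(1 <= i < d.+1) M k i w *m v (k - i)%N w))} <->
    forall h, at_rep v k h = - (invmx (at_rep G k h) *m drift path_A path_B d
      (at_rep M0) (fun k i h => M k i (rep h)) z0 (at_rep v) k 0 h).
  move=> kN; rewrite (@ae_path _ _ _ _ theta K).
    by split=> e h; have := e h; rewrite /drift !addn0 state_path.
  move=> w w' e; have kK : (k - d <= K)%N by lia.
  rewrite (admissible_adaptedK av _ e); last by lia.
  rewrite (adapted_le (Gamma_adapted (k := k) _) kK e); last by lia.
  rewrite (adapted_le (recursion_M0_adapted (k := k) _) kK e); last by lia.
  rewrite (state_adaptedK z0 av _ e); last by lia.
  congr (_ = - (_ *m (_ + _))); apply: eq_big_nat => i id.
  rewrite (adapted_le (recursion_M_adapted (k := k) (i := i) _ _) kK e); [|by lia..].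
  by rewrite (admissible_adaptedK av _ e) //; lia.
by split=> e k kN; apply/law_at => //; apply: e.
Qed.

Definition costate_formula z0 v k w : 'cV[R]_(n + m) :=
  Pb k w *m z z0 v k w
  - \sum_(0 <= s < d)
      (F k s.+1 w *m invmx (G (k + s)%N w) *m M0 (k + s)%N w
       *m z z0 v (k - d + s)%N w)
  - \sum_(0 <= s < d)
      (F k s.+1 w *m invmx (G (k + s)%N w) *m
       \sum_(s.+1 <= i < d.+1) M (k + s)%N i w *m v (k - i + s)%N w).

Lemma costate_formula_path z0 v k h : (d <= k <= N)%N ->
  costate_formula z0 v k (rep h) =
  closed_costate path_A path_B d (at_rep Pb) (at_rep G) (at_rep M0)
    (fun k i h => M k i (rep h)) (fun k i h => F k i (rep h)) z0 (at_rep v) k h.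
Proof.
move=> kN; rewrite /costate_formula /closed_costate -state_path -addrA -opprD.
congr (_ - _); rewrite -big_split; apply: eq_big_nat => s sd /=.
rewrite /drift mulmxDr -state_path !mulmxA; congr (_ + _ *m _).
by apply: eq_big_nat => i id; congr (_ *m v _ _); lia.
Qed.

Lemma costate_formula_adapted z0 uinit v k : admissible theta N uinit v ->
  (d <= k <= N)%N -> adapted th K (costate_formula z0 v k).
Proof.
move=> av kN w w' e; have kK : (k <= K)%N by lia.
rewrite /costate_formula (adapted_le (Pbar_adapted (k := k) _) kK e); last by lia.
have FG s : (0 <= s < d)%N -> F k s.+1 w *m invmx (G (k + s)%N w) =
    F k s.+1 w' *m invmx (G (k + s)%N w').
  move=> sd; rewrite (adapted_le (Fmx_adapted (k := k) (i := s.+1) _ _) kK e) //.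
  by rewrite (adapted_le (Gamma_adapted (k := k + s) _) _ e) //; lia.
rewrite (state_adaptedK z0 av _ e); last by lia.
congr (_ - _ - _); apply: eq_big_nat => s sd; rewrite FG //.
  rewrite (adapted_le (recursion_M0_adapted (k := k + s) _) _ e); [|by lia..].
  by rewrite (state_adaptedK z0 av _ e) //; lia.
congr (_ *m _); apply: eq_big_nat => i id.
rewrite (adapted_le (recursion_M_adapted (k := k + s) (i := i) _ _) _ e); [|by lia..].
by rewrite (admissible_adaptedK av _ e) //; lia.
Qed.

Lemma optimal_cost z0 uinit v : posdef_all -> optimal z0 uinit v ->
  cost theta A B Q Rw PN1 N z0 v = ('E_P[(fun w =>
     \sum_(0 <= k < d) (qform Q (z z0 v k w) + qform Rw (v k w))
     + qform (Pb d w) (z z0 v d w)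
     - ((z z0 v d w)^T *m \sum_(0 <= s < d)
          (F d s.+1 w *m invmx (G (s + d)%N w) *m M0 (s + d)%N w
           *m z z0 v s w)) ord0 ord0
     - ((z z0 v d w)^T *m \sum_(0 <= s < d.+1)
          (F d s.+1 w *m invmx (G (s + d)%N w) *m
           \sum_(s.+1 <= i < d.+1)
              M (s + d)%N i w *m v (s + d - i)%N w)) ord0 ord0)%R])%E.
Proof.
move=> /Gamma_posdef_path Gpos opt; have av := opt.1.
rewrite (cost_path z0 av).
rewrite (fopt_cost pos Aad Bad dN Q_psd Rw_psd PN1_psd ric Gpos
  ((optimal_path z0 av).1 opt)).
have -> : (fun w => \sum_(0 <= k < d) (qform Q (z z0 v k w) + qform Rw (v k w))
     + qform (Pb d w) (z z0 v d w)
     - ((z z0 v d w)^T *m \sum_(0 <= s < d)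
          (F d s.+1 w *m invmx (G (s + d)%N w) *m M0 (s + d)%N w
           *m z z0 v s w)) ord0 ord0
     - ((z z0 v d w)^T *m \sum_(0 <= s < d.+1)
          (F d s.+1 w *m invmx (G (s + d)%N w) *m
           \sum_(s.+1 <= i < d.+1)
              M (s + d)%N i w *m v (s + d - i)%N w)) ord0 ord0) =
  (fun w => \sum_(0 <= k < d) (qform Q (z z0 v k w) + qform Rw (v k w))
     + ((z z0 v d w)^T *m costate_formula z0 v d w) ord0 ord0).
  have entryB (x : 'rV[R]_(n + m)) (X Y W : 'cV[R]_(n + m)) :
      (x *m (X - Y - W)) ord0 ord0 =
      (x *m X) ord0 ord0 - (x *m Y) ord0 ord0 - (x *m W) ord0 ord0.
    by rewrite !mulmxBr !mxE.
  apply/funext => w; rewrite /costate_formula entryB /qform mulmxA -!addrA.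
  congr (_ + (_ + (_ + _))); congr (- fun_of_matrix (_ *m _) _ _).
    by apply: eq_big_nat => s sd; rewrite subnn add0n [(s + d)%N]addnC.
  rewrite big_nat_recr //= [X in _ *m X]big_geq // mulmx0 addr0.
  apply: eq_big_nat => s sd; rewrite [(s + d)%N]addnC; congr (_ *m _).
  by apply: eq_big_nat => i id; congr (_ *m v _ _); lia.
rewrite (@expectation_path _ _ _ P theta K).
  congr EFin; congr (mean _ _); apply/funext => h.
  rewrite costate_formula_path ?leqnn // -state_path; congr (_ + _).
  by apply: eq_bigr => k _; rewrite state_path.
move=> w w' e; rewrite (costate_formula_adapted z0 av _ e) ?leqnn //.
rewrite (state_adaptedK z0 av _ e); last by lia.
congr (_ + _); apply: eq_big_nat => k kd.
rewrite (state_adaptedK z0 av _ e); last by lia.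
by rewrite (admissible_adaptedK av _ e) //; lia.
Qed.

Lemma fbsde_path z0 uinit v lam : admissible theta N uinit v ->
  (forall k, (d <= k <= N.+1)%N -> adapted th k (lam k)) ->
  fbsde_solution theta A B Q Rw PN1 N z0 uinit v lam <->
  costate pp pth path_A path_B Q PN1 d N z0 (at_rep v) (at_rep lam) /\
  stationary pp pth path_B Rw d N (at_rep v) (at_rep lam).
Proof.
move=> av la.
have laK k : (d <= k <= N.+1)%N -> adapted th K (lam k).
  by move=> kN; apply: adapted_le (la k kN) _; lia.
have Alam k : (d <= k <= N)%N -> adapted th K (fun w => (Abar A B (theta k w))^T *m lam k.+1 w).
  move=> kN w w' e; rewrite (laK k.+1 _ _ _ e); last by lia.
  by rewrite (theta_adaptedK _ e) //; lia.
have Blam k : (d <= k <= N)%N -> adapted th K (fun w => (Bbar B (theta k w))^T *m lam k.+1 w).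
  move=> kN w w' e; rewrite (laK k.+1 _ _ _ e); last by lia.
  by rewrite (theta_adaptedK _ e) //; lia.
have EK k j a b (X : T -> 'M[R]_(a, b)) : (k <= K)%N -> (j <= k)%N ->
    adapted th K (Epast theta j X).
  by move=> kK jk; apply: adapted_le (@Epast_adapted _ _ _ _ _ _ _ _ _) _; lia.
have stat k : (d <= k <= N)%N -> {ae P, forall w,
     0 = Epast theta (k - d) (fun w' => (Bbar B (theta k w'))^T *m lam k.+1 w') w
         + Rw *m v k w} <->
   forall h, gradient pp pth path_B Rw d (at_rep v) (at_rep lam) k h = 0.
  move=> kN; rewrite (@ae_path _ _ _ _ theta K); last first.
    move=> w w' e; rewrite (admissible_adaptedK av _ e); last by lia.
    by rewrite (EK k _ _ _ _ _ _ _ _ e) //; lia.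
  split=> e h; have := e h; rewrite /gradient addrC Epast_path //; try (by lia);
    by [exact: Blam|move=> <-].
have adj k : (d <= k <= N)%N -> {ae P, forall w,
     lam k w = Q *m z z0 v k w
       + Epast theta k (fun w' => (Abar A B (theta k w'))^T *m lam k.+1 w') w} <->
   forall h, lam k (rep h) = Q *m traj path_A path_B z0 (at_rep v) k h
       + condE pp pth k (fun h => (path_A k h)^T *m lam k.+1 (rep h)) h.
  move=> kN; rewrite (@ae_path _ _ _ _ theta K); last first.
    move=> w w' e; rewrite (laK k _ _ _ e); last by lia.
    rewrite (state_adaptedK z0 av _ e); last by lia.
    by rewrite (EK k _ _ _ _ _ _ _ _ e) //; lia.
  split=> e h; have := e h; rewrite state_path Epast_path //; try (by lia);
    exact: Alam.
have fin : {ae P, forall w, lam N.+1 w = PN1 *m z z0 v N.+1 w} <->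
    forall h, lam N.+1 (rep h) = PN1 *m traj path_A path_B z0 (at_rep v) N.+1 h.
  rewrite (@ae_path _ _ _ _ theta K); last first.
    move=> w w' e; rewrite (laK N.+1 _ _ _ e); last by lia.
    by rewrite (state_adaptedK z0 av (leqnn _) e).
  by split=> e h; have := e h; rewrite state_path.
split=> [[_ _ st ad en]|[[ad en] st]].
  split; last by move=> k h kN; move: h; apply/stat => //; apply: st.
  split; first by move=> k h kN; move: h; apply/adj => //; apply: ad.
  exact/fin.
split=> //; last exact/fin.
- by move=> k kN; apply/sub_measurable_mxP; apply: la.
- by move=> k kN; apply/stat => // h; apply: st.
- by move=> k kN; apply/adj => // h; apply: ad.
Qed.

Lemma fbsde_exists z0 uinit v : optimal z0 uinit v ->
  exists lam, fbsde_solution theta A B Q Rw PN1 N z0 uinit v lam.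
Proof.
move=> opt; have av := opt.1; have fo := (optimal_path z0 av).1 opt.
have [mu muE] := costate_ex pp pth path_A path_B Q PN1 d N z0 (at_rep v).
have lift k : exists Y : T -> 'cV[R]_(n + m), (d <= k <= N.+1)%N ->
    adapted th k Y /\ forall h, Y (rep h) = mu k h.
  have [kN|kN] := boolP (d <= k <= N.+1)%N; last by exists (fun=> 0).
  have [Y hY] := path_lift 0 (costate_adapted Aad Bad dN fo.1 muE kN).
  by exists Y.
have [lam hlam] := choice lift.
exists lam; apply/fbsde_path => // [k kN|]; first by case: (hlam k kN).
have lamE k h : (d <= k <= N.+1)%N -> lam k (rep h) = mu k h.
  by move=> kN; have [_ ->] := hlam k kN.
have lamE' : costate pp pth path_A path_B Q PN1 d N z0 (at_rep v) (at_rep lam).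
  split=> [k h kN|h]; last by rewrite lamE ?muE.2 //; lia.
  rewrite lamE; last by lia.
  rewrite (muE.1 _ _ kN); congr (_ + condE _ _ _ _ _).
  by apply/funext => h'; rewrite lamE //; lia.
split=> //.
exact: (opt_stationary pos Aad Bad dN Q_psd Rw_psd PN1_psd fo lamE').
Qed.

Lemma fbsde_closed z0 uinit v lam : posdef_all ->
  fbsde_solution theta A B Q Rw PN1 N z0 uinit v lam ->
  optimal z0 uinit v /\ forall k, (d <= k <= N)%N ->
    {ae P, forall w, lam k w = costate_formula z0 v k w}.
Proof.
move=> /Gamma_posdef_path Gpos sol; have [av lm _ _ _] := sol.
have la k : (d <= k <= N.+1)%N -> adapted th k (lam k).
  by move=> kN; apply/sub_measurable_mxP; apply: lm.
have [ad st] := (fbsde_path z0 av la).1 sol.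
have [fo closed] := stationary_closed pos Aad Bad dN Q_psd Rw_psd PN1_psd ric
  Gpos (admissible_causal av) ad st.
split=> [|k kN]; first exact/(optimal_path z0 av).
apply/(@ae_path _ _ _ _ theta K) => [|h].
  apply: adapted2; last exact: (costate_formula_adapted z0 av kN).
  by apply: adapted_le (la k _) _; lia.
by rewrite costate_formula_path //; apply: closed; lia.
Qed.

End Transfer.

Theorem theorem1 (disp : measure_display) (T : measurableType disp)
    (R : realType) (P : probability T R)
    (n m d N : nat) (n_gt0 : (0 < n)%N) (m_gt0 : (0 < m)%N) (d_le_N : (d <= N)%N)
    (theta : nat -> {RV P >-> bool}) (xi : bool -> bool -> R)
    (theta_markov : is_markov_chain theta xi)
    (A : 'M[R]_n) (B : 'M[R]_(n, m))
    (Q : 'M[R]_(n + m)) (Rw : 'M[R]_m) (PN1 : 'M[R]_(n + m))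
    (Q_psd : possemidefmx Q) (Rw_psd : possemidefmx Rw)
    (PN1_psd : possemidefmx PN1)
    (z0 : 'cV[R]_(n + m)) (uinit : 'I_d -> 'cV[R]_m) :
  let z := state theta A B z0 in
  let Pb := Pbar theta A B Q Rw PN1 d N in
  let G := Gamma theta A B Q Rw PN1 d N in
  let M0 := M0 theta A B Q Rw PN1 d N in
  let M := M theta A B Q Rw PN1 d N in
  let F := Fmx theta A B Q Rw PN1 d N in
  let J := cost theta A B Q Rw PN1 N z0 in
  let Optimal := optimal theta A B Q Rw PN1 N z0 uinit in
  let Fbsde := fbsde_solution theta A B Q Rw PN1 N z0 uinit in
  let Gamma_posdef := forall k, (d <= k <= N)%N ->
    {ae P, forall w, posdefmx (G k w)} in
  (has_unique_solution theta A B Q Rw PN1 N z0 uinit <-> Gamma_posdef) /\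
  (Gamma_posdef ->
   [/\ (* optimal controller; v k is u^c_(k-d) *)
       forall v, admissible theta N uinit v ->
         (Optimal v <->
          forall k, (d <= k <= N)%N -> {ae P, forall w,
            v k w = - (invmx (G k w) *m
              (M0 k w *m z v (k - d)%N w
               + \sum_(1 <= i < d.+1) M k i w *m v (k - i)%N w))}),
       (* optimal value *)
       forall v, Optimal v ->
         J v = ('E_P[(fun w =>
           \sum_(0 <= k < d) (qform Q (z v k w) + qform Rw (v k w))
           + qform (Pb d w) (z v d w)
           - ((z v d w)^T *m \sum_(0 <= s < d)
                (F d s.+1 w *m invmx (G (s + d)%N w) *m M0 (s + d)%N w
                 *m z v s w)) ord0 ord0
           - ((z v d w)^T *m \sum_(0 <= s < d.+1)
                (F d s.+1 w *m invmx (G (s + d)%N w) *m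
                 \sum_(s.+1 <= i < d.+1)
                    M (s + d)%N i w *m v (s + d - i)%N w)) ord0 ord0)%R])%E,
       (* forward-backward equations: existence *)
       forall v, Optimal v -> exists lam, Fbsde v lam &
       (* forward-backward equations: form of the solution *)
       forall v lam, Fbsde v lam ->
         Optimal v /\
         forall k, (d <= k <= N)%N -> {ae P, forall w,
           lam k w = Pb k w *m z v k w
             - \sum_(0 <= s < d)
                 (F k s.+1 w *m invmx (G (k + s)%N w) *m M0 (k + s)%N w
                  *m z v (k - d + s)%N w)
             - \sum_(0 <= s < d)
                 (F k s.+1 w *m invmx (G (k + s)%N w) *m
                  \sum_(s.+1 <= i < d.+1)
                     M (k + s)%N i w *m v (k - i + s)%N w)}]).
Proof.
move=> z Pb G M0 M F J Optimal Fbsde Gamma_posdef.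
split; first exact: unique_solution_posdef.
move=> Gpos; split.
- by move=> v av; apply: optimal_feedback.
- by move=> v opt; exact: (optimal_cost d_le_N Q_psd Rw_psd PN1_psd Gpos opt).
- by move=> v; apply: fbsde_exists.
- by move=> v lam; apply: fbsde_closed.
Qed.
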